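(* Let $(\mathcal R,C,\mathcal H)$ be a regular realizability category, with inclusion $I:\mathcal H\to\mathcal R$ and reflector $R:\mathcal R\to\mathcal H$. Then $I:\mathcal H\to\mathcal R$ is equivalent to $\nabla:\mathcal H\to\mathrm{Asm}(\mathsf DRC/\chi)$ for some external filter $\chi$ of $RC$.
   Context: All categories are small. A Heyting category is a regular category in which every $\mathrm{Sub}(X)$ has finite joins and every $f^{-1}$ between subobject posets has a right adjoint. Set-builder notation refers to its internal language. Order partial applicative structure: an object $A$ with a preorder $\le$ and a partial binary operator $(x,y)\mapsto xy$ with domain $D\subseteq A^2$ ($xy\downarrow$ means $(x,y)\in D$) such that $x\le x'$, $y\le y'$, $x'y'\downarrow$ imply $xy\downarrow$, $xy\le x'y'$. Partial combinatory functions are the least class of partial functions $A^n\rightharpoonup A$ (all arities) containing projections and closed under pointwise application. For $f:A^{n+1}\rightharpoonup A$, $[\![f]\!]=\{r\in A\mid\forall\vec x\in A^n.\,r\vec x\downarrow,\ \forall\vec y\in\mathrm{dom}f.\ r\vec y\downarrow\wedge r\vec y\le f(\vec y)\}$. A filter of $A$ is a subobject closed under application and upward closed; it is combinatory complete if its intersection with each $[\![f]\!]$, $f$ partial combinatory, is inhabited. An order partial combinatory algebra is an order partial applicative structure with a combinatory complete filter. $\mathbf DA$ is the set of downward closed subobjects of $A$; $UV\downarrow$ iff $U\times V\subseteq D$, and then $UV=\{z\mid\exists x\in U,y\in V.\,z\le xy\}$. An external filter is $\phi\subseteq\mathbf DA$ upward closed under $\subseteq$ and closed under defined application (combinatory complete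 if $[\![f]\!]\in\phi$ for all partial combinatory $f$). Realizability fibration $\mathsf DA/\phi:\mathcal DA/\phi\to\mathcal H$: objects are pairs $(X,Y)$ with $Y\subseteq A\times X$ downward closed in the $A$-coordinate; a morphism $(X,Y)\to(X',Y')$ is $f:X\to X'$ such that for some $U\in\phi$, for all $u\in U$, $(a,x)\in Y$, $ua\downarrow$ and $(ua,f(x))\in Y'$. $\mathrm{Asm}(\mathsf DA/\phi)$ is the localization of $\mathcal DA/\phi$ at the monomorphisms that are supine (coCartesian) over $\mathcal H$; $\nabla:\mathcal H\to\mathrm{Asm}(\mathsf DA/\phi)$ is the constant object functor $X\mapsto(X,A\times X)$. Regular realizability category $(\mathcal R,C,\mathcal H)$: $\mathcal R$ is a Heyting category, $C\in\mathcal R$ an order partial combinatory algebra, $\mathcal H$ a reflective subcategory with fully faithful regular inclusion $I:\mathcal H\to\mathcal R$ and reflector $R:\mathcal R\to\mathcal H$ that is faithful and preserves finite limits. An arrow of $\mathcal R$ is prone if the naturality square at it of the unit $\mathrm{id}\to IR$ is a pullback. A morphism $f:X\to Y$ is a prodo morphism if $f$ factors as a prone arrow $X\to C\times Y$ followed by the projection $C\times Y\to Y$ and the fibres of $f$ are isomorphic to downsets of $C$ (so $X\subseteq C\times Y$ downward closed in $C$). The following are required: 1. Weak genericity: for each object $X$ there is a span $(e:Y\to X,p:Y\to C)$ where $e$ is a regular epimorphism and $p$ is prone. 2. Tracking principle: for each $e:X\to Y$, $f:Y\to Z$, where $e$ is a regular epic prodo morphism and $f$ is either a prodo morphism or a prone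 morphism, there is a regular epic prodo morphism $g:W\to Z$ such that the pullback $W\times_ZX\to W\times_ZY$ of $e$ along $g$ is split. Moreover, if $f$ is a prodo morphism, the splitting is a restriction of the application map (it is given by $(w,y,z)\mapsto(wy,y,z)\in X$ for $(w,z)\in W$, $(y,z)\in Y\subseteq C\times Z$); if $f$ is prone, the splitting is an inclusion ($(w,y)\in X$ whenever $(w,f(y))\in W$).
   Formalization: It is also assumed that C, embedded in IRC by the unit, is a filter of IRC (closed under defined application, upward closed) with the induced order and domain of application; otherwise the claim fails: R=Asm(K1), H=Set, C=N with x≤y always and any total application. *)

(* Defs.v *)
From mathcomp Require Import all_boot boolp.

Set Implicit Arguments.
Unset Strict Implicit.
Unset Printing Implicit Defensive.

Declare Scope cat_scope.
Delimit Scope cat_scope with cat.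
Local Open Scope quotient_scope.
Local Open Scope cat_scope.

Record Category := MkCategory {
  Ob :> Type;
  Hom : Ob -> Ob -> Type;
  idm : forall X, Hom X X;
  comp : forall X Y Z, Hom Y Z -> Hom X Y -> Hom X Z;
  comp_assoc : forall W X Y Z (h : Hom Y Z) (g : Hom X Y) (f : Hom W X),
    comp h (comp g f) = comp (comp h g) f;
  comp_idl : forall X Y (f : Hom X Y), comp (idm Y) f = f;
  comp_idr : forall X Y (f : Hom X Y), comp f (idm X) = f }.

Arguments Hom {_} X Y.
Arguments idm {_} X.
Arguments comp {_ X Y Z} g f.
Notation "g ∘ f" := (comp g f) (at level 40, left associativity) : cat_scope.

Record Functor (C D : Category) := MkFunctor {
  fob :> C -> D;
  fmap : forall X Y : C, Hom X Y -> Hom (fob X) (fob Y);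
  fmap_id : forall X, fmap (idm X) = idm (fob X);
  fmap_comp : forall X Y Z (g : Hom Y Z) (f : Hom X Y),
    fmap (g ∘ f) = fmap g ∘ fmap f }.

Arguments fmap {C D} F {X Y} f : rename.

Definition functor_id (C : Category) : Functor C C :=
  @MkFunctor C C (fun X => X) (fun X Y f => f) (fun X => erefl) (fun X Y Z g f => erefl).

Program Definition functor_comp (C D E : Category) (G : Functor D E) (F : Functor C D) :
  Functor C E :=
  @MkFunctor C E (fun X => G (F X)) (fun X Y f => fmap G (fmap F f)) _ _.
Next Obligation. by rewrite !fmap_id. Qed.
Next Obligation. by rewrite !fmap_comp. Qed.

Definition is_iso (C : Category) (X Y : C) (f : Hom X Y) : Prop :=
  exists g : Hom Y X, g ∘ f = idm X /\ f ∘ g = idm Y.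

Definition nat_iso (C D : Category) (F G : Functor C D) : Prop :=
  exists t : forall X : C, Hom (F X) (G X),
    (forall X, is_iso (t X)) /\
    (forall X Y (f : Hom X Y), t Y ∘ fmap F f = fmap G f ∘ t X).

Definition is_equivalence (C D : Category) (E : Functor C D) : Prop :=
  exists E' : Functor D C,
    nat_iso (functor_comp E' E) (functor_id C) /\
    nat_iso (functor_comp E E') (functor_id D).

(* Equivalence of functors with common domain, as objects of the slice under it. *)
Definition equivalent_under (H C D : Category) (F : Functor H C) (G : Functor H D) : Prop :=
  exists E : Functor C D, is_equivalence E /\ nat_iso (functor_comp E F) G.

Definition full (C D : Category) (F : Functor C D) : Prop :=
  forall X Y (g : Hom (F X) (F Y)), exists f : Hom X Y, fmap F f = g.

Definition faithful (C D : Category) (F : Functor C D) : Prop :=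
  forall X Y (f g : Hom X Y), fmap F f = fmap F g -> f = g.

Section Limits.
Context {C : Category}.

Definition monic (X Y : C) (m : Hom X Y) : Prop :=
  forall Z (f g : Hom Z X), m ∘ f = m ∘ g -> f = g.

Definition jointly_monic (S X Y : C) (a : Hom S X) (b : Hom S Y) : Prop :=
  forall Z (f g : Hom Z S), a ∘ f = a ∘ g -> b ∘ f = b ∘ g -> f = g.

Definition is_terminal (T : C) : Prop := forall X : C, exists! f : Hom X T, True.

Definition is_product (A B P : C) (p : Hom P A) (q : Hom P B) : Prop :=
  forall Z (a : Hom Z A) (b : Hom Z B), exists! h : Hom Z P, p ∘ h = a /\ q ∘ h = b.

Definition is_pullback (X Y Z P : C) (f : Hom X Z) (g : Hom Y Z)
    (p : Hom P X) (q : Hom P Y) : Prop :=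
  f ∘ p = g ∘ q /\
  forall W (a : Hom W X) (b : Hom W Y), f ∘ a = g ∘ b ->
    exists! h : Hom W P, p ∘ h = a /\ q ∘ h = b.

Definition regular_epi (X Y : C) (e : Hom X Y) : Prop :=
  exists K (p q : Hom K X), e ∘ p = e ∘ q /\
    forall Z (f : Hom X Z), f ∘ p = f ∘ q -> exists! h : Hom Y Z, h ∘ e = f.

End Limits.

(* Finite limits are generated by terminal objects and pullbacks. *)
Definition has_finite_limits (C : Category) : Prop :=
  (exists T : C, is_terminal T) /\
  (forall (X Y Z : C) (f : Hom X Z) (g : Hom Y Z),
     exists P (p : Hom P X) (q : Hom P Y), is_pullback f g p q).

Definition preserves_finite_limits (C D : Category) (F : Functor C D) : Prop :=
  (forall T : C, is_terminal T -> is_terminal (F T)) /\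
  (forall (X Y Z P : C) (f : Hom X Z) (g : Hom Y Z) (p : Hom P X) (q : Hom P Y),
     is_pullback f g p q -> is_pullback (fmap F f) (fmap F g) (fmap F p) (fmap F q)).

Record regular_category (C : Category) : Prop := {
  reg_finite_limits : has_finite_limits C;
  reg_image : forall (X Y : C) (f : Hom X Y),
    exists M (e : Hom X M) (m : Hom M Y), [/\ regular_epi e, monic m & m ∘ e = f];
  reg_stable : forall (X Y Z P : C) (e : Hom X Z) (g : Hom Y Z)
      (p : Hom P X) (q : Hom P Y),
    is_pullback e g p q -> regular_epi e -> regular_epi q }.

Record regular_functor (C D : Category) (F : Functor C D) : Prop := {
  regf_lex : preserves_finite_limits F;
  regf_epi : forall (X Y : C) (e : Hom X Y), regular_epi e -> regular_epi (fmap F e) }.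

Record Sub (C : Category) (X : C) := MkSub {
  sub_ob : C;
  sub_mono : Hom sub_ob X;
  sub_monic : monic sub_mono }.

(* [mem U x]: the generalized element [x] of [X] belongs to the subobject [U]. *)
Definition mem (C : Category) (X : C) (U : Sub X) (G : C) (x : Hom G X) : Prop :=
  exists y : Hom G (sub_ob U), sub_mono U ∘ y = x.

Definition sub_le (C : Category) (X : C) (U V : Sub X) : Prop := mem V (sub_mono U).

Definition is_inverse_image (C : Category) (X Y : C) (f : Hom X Y)
    (V : Sub Y) (U : Sub X) : Prop :=
  exists g : Hom (sub_ob U) (sub_ob V), is_pullback (sub_mono V) f g (sub_mono U).

Record heyting_category (C : Category) : Prop := {
  hey_regular : regular_category C;
  hey_bottom : forall X : C, exists B : Sub X, forall U : Sub X, sub_le B U;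
  hey_join : forall (X : C) (U V : Sub X), exists J : Sub X,
    forall W : Sub X, sub_le J W <-> sub_le U W /\ sub_le V W;
  hey_forall : forall (X Y : C) (f : Hom X Y) (U : Sub X), exists V : Sub Y,
    forall (T : Sub Y) (S : Sub X), is_inverse_image f T S ->
      (sub_le S U <-> sub_le T V) }.

(* Internal language: a formula with one free variable of sort [X] is interpreted by its forcing
  relation (Kripke-Joyal semantics), a [spred X]: for every stage [G], the generalized elements
  [G -> X] that satisfy it. Atomic formulas and conjunction are read stagewise,
  universal quantification and implication range over all later stages [D -> G],
  and existential quantification is read along a regular epimorphic cover of
  the stage ([locally]); the cover is omitted where the witness is unique.
  [classifies U P] says that the subobject [U] is [{x in X | P x}]. *)

Definition spred (C : Category) (X : C) := forall G : C, Hom G X -> Prop.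

Definition classifies (C : Category) (X : C) (U : Sub X) (P : spred X) : Prop :=
  forall G (x : Hom G X), mem U x <-> P G x.

Definition locally (C : Category) (G : C) (P : forall D, Hom D G -> Prop) : Prop :=
  exists D (e : Hom D G), regular_epi e /\ P D e.

Definition inhabited (C : Category) (X : C) (P : spred X) : Prop :=
  forall G : C, locally (fun D (_ : Hom D G) => exists x : Hom D X, P D x).

(* Both the order and the domain of application are subobjects of [A x A],
   presented as jointly monic spans. *)
Record appStruct (C : Category) := MkAppStruct {
  carrier :> C;
  le_ob : C;
  le_fst : Hom le_ob carrier;
  le_snd : Hom le_ob carrier;
  le_monic : jointly_monic le_fst le_snd;
  app_dom : C;
  app_fst : Hom app_dom carrier;
  app_snd : Hom app_dom carrier;
  app_monic : jointly_monic app_fst app_snd;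
  app_val : Hom app_dom carrier }.

Section AppStruct.
Context {C : Category} (A : appStruct C).

Definition ole (G : C) (x y : Hom G A) : Prop :=
  exists l : Hom G (le_ob A), le_fst A ∘ l = x /\ le_snd A ∘ l = y.

(* [x y] is defined and equal to [z]. *)
Definition oapp (G : C) (x y z : Hom G A) : Prop :=
  exists d : Hom G (app_dom A),
    [/\ app_fst A ∘ d = x, app_snd A ∘ d = y & app_val A ∘ d = z].

(* [r x_1 ... x_n] (associated to the left) is defined and equal to [z]. *)
Fixpoint iapp (G : C) (r : Hom G A) (xs : seq (Hom G A)) (z : Hom G A) : Prop :=
  if xs is x :: xs' then exists w, oapp r x w /\ iapp w xs' z else z = r.

End AppStruct.

Record OPAS (C : Category) := MkOPAS {
  opas_struct :> appStruct C;
  opas_refl : forall (G : C) (x : Hom G opas_struct), ole x x;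
  opas_trans : forall (G : C) (x y z : Hom G opas_struct), ole x y -> ole y z -> ole x z;
  opas_mono : forall (G : C) (x x' y y' z' : Hom G opas_struct),
    ole x x' -> ole y y' -> oapp x' y' z' -> exists z, oapp x y z /\ ole z z' }.

(* The partial combinatory functions [A^n -> A] are those denoted by the terms
   generated from the projections by (pointwise) application. *)
Inductive pterm (n : nat) :=
  | PProj of 'I_n
  | PApp of pterm n & pterm n.

Section Combinatory.
Context {C : Category} (A : OPAS C).

(* The tuple [y] is in the domain of the function denoted by [t], with value [v]. *)
Fixpoint peval n (t : pterm n) (G : C) (y : n.-tuple (Hom G A)) (v : Hom G A) : Prop :=
  match t with
  | PProj i => v = tnth y i
  | PApp s s' => exists a b, [/\ peval s y a, peval s' y b & oapp a b v]
  end.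

Definition realizers n (f : pterm n.+1) : spred (A : C) := fun G r =>
  forall D (u : Hom D G),
    (forall x : n.-tuple (Hom D A), exists w, iapp (r ∘ u) x w) /\
    (forall (y : n.+1.-tuple (Hom D A)) v, peval f y v ->
       exists w, iapp (r ∘ u) y w /\ ole w v).

Definition is_filter (F : spred (A : C)) : Prop :=
  (forall G (x y z : Hom G A), F G x -> F G y -> oapp x y z -> F G z) /\
  (forall G (x y : Hom G A), F G x -> ole x y -> F G y).

Definition combinatory_complete (F : spred (A : C)) : Prop :=
  forall n (f : pterm n.+1), inhabited (fun G r => F G r /\ realizers f r).

Record downset := MkDownset {
  ds_sub :> Sub (A : C);
  ds_down : forall G (x y : Hom G A), ole x y -> mem ds_sub y -> mem ds_sub x }.

Definition ds_app_defined (U V : downset) : Prop :=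
  forall G (x y : Hom G A), mem U x -> mem V y -> exists z, oapp x y z.

Definition is_ds_app (U V W : downset) : Prop :=
  classifies W (fun G z => locally (fun D (e : Hom D G) =>
    exists x y w, [/\ mem U x, mem V y, oapp x y w & ole (z ∘ e) w])).

Record external_filter := MkExternalFilter {
  ef_mem :> downset -> Prop;
  ef_up : forall U V : downset, ef_mem U -> sub_le U V -> ef_mem V;
  ef_app : forall U V W : downset, ef_mem U -> ef_mem V -> ds_app_defined U V ->
    is_ds_app U V W -> ef_mem W }.

(* Completeness is what makes tracked maps closed under identities and composition. *)
Definition ef_complete (phi : external_filter) : Prop :=
  forall n (f : pterm n.+1), exists U : downset, phi U /\ classifies U (realizers f).

End Combinatory.

Record OPCA (C : Category) := MkOPCA {
  opca_opas :> OPAS C;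
  opca_filter : Sub (opca_opas : C);
  opca_is_filter : is_filter (fun G x => mem opca_filter x);
  opca_complete : combinatory_complete (fun G x => mem opca_filter x) }.

Section Image.
Context {C D : Category} (F : Functor C D).
Hypotheses (limC : has_finite_limits C) (lexF : preserves_finite_limits F).

Lemma has_products (A B : C) : exists P (p : Hom P A) (q : Hom P B), is_product p q.
Proof.
have [[T hT] hP] := limC.
have [a [_ _]] := hT A; have [b [_ _]] := hT B.
have [P [p [q [_ up]]]] := hP _ _ _ a b; exists P, p, q => Z x y; apply: up.
by have [t [_ ut]] := hT Z; rewrite -(ut (a ∘ x)) // -(ut (b ∘ y)).
Qed.

Lemma terminal_eq (E : Category) (T X : E) (f g : Hom X T) : is_terminal T -> f = g.
Proof. by move=> hT; have [t [_ ut]] := hT X; rewrite -(ut f) // -(ut g). Qed.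

Lemma fmap_monic (X Y : C) (m : Hom X Y) : monic m -> monic (fmap F m).
Proof.
move=> mm; have pb : is_pullback m m (idm X) (idm X).
  split=> // W a b /mm <-; exists a; split; first by rewrite comp_idl.
  by move=> h [<- _]; rewrite comp_idl.
have [_ up] := lexF.2 _ _ _ _ _ _ _ _ pb.
move=> Z f g efg; have [h [[h1 h2] _]] := up Z f g efg.
by rewrite -h1 -h2.
Qed.

Lemma fmap_jointly_monic (S X Y : C) (a : Hom S X) (b : Hom S Y) :
  jointly_monic a b -> jointly_monic (fmap F a) (fmap F b).
Proof.
move=> jm; have [[T hT] hP] := limC.
have [x [_ _]] := hT X; have [y [_ _]] := hT Y.
have [P [p [q pb]]] := hP _ _ _ x y.
have [_ up] := pb.
have [m [[m1 m2] _]] := up S a b (terminal_eq _ _ hT).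
have mm : monic m.
  by move=> Z f g e; apply: jm; rewrite -?m1 -?m2 -!comp_assoc e.
have [_ Fup] := lexF.2 _ _ _ _ _ _ _ _ pb.
move=> Z f g ea eb; apply: (fmap_monic mm).
have [h [_ uh]] := Fup Z (fmap F a ∘ f) (fmap F b ∘ f) (terminal_eq _ _ (lexF.1 _ hT)).
rewrite -(uh (fmap F m ∘ f)); first apply: uh; last first.
  by rewrite !comp_assoc -!fmap_comp m1 m2.
by rewrite !comp_assoc -!fmap_comp m1 m2 ea eb.
Qed.

Definition fmap_appStruct (A : appStruct C) : appStruct D :=
  MkAppStruct (fmap_jointly_monic (@le_monic _ A)) (fmap_jointly_monic (@app_monic _ A))
    (fmap F (app_val A)).

Section ImageOPAS.
Variable A : OPAS C.
Let FA := fmap_appStruct A.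

Lemma fmap_refl (G : D) (x : Hom G FA) : ole x x.
Proof.
have [l [l1 l2]] := opas_refl (idm (A : C)).
exists (fmap F l ∘ x); split; rewrite /= comp_assoc -fmap_comp.
  by rewrite l1 fmap_id comp_idl.
by rewrite l2 fmap_id comp_idl.
Qed.

Lemma fmap_trans (G : D) (x y z : Hom G FA) : ole x y -> ole y z -> ole x z.
Proof.
move=> [l [<- l2]] [k [k1 <-]]; rewrite /= in l2 k1 *.
have [P [p [q pb]]] := limC.2 _ _ _ (le_snd A) (le_fst A).
have [_ up] := lexF.2 _ _ _ _ _ _ _ _ pb.
have [h [[<- <-] _]] := up G l k (etrans l2 (esym k1)).
have := @opas_trans _ A P (le_fst A ∘ p) (le_snd A ∘ p) (le_snd A ∘ q).
case; [by exists p|by exists q; split; first rewrite pb.1|].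
move=> m [m1 m2]; exists (fmap F m ∘ h).
by rewrite /= !comp_assoc -!fmap_comp m1 m2.
Qed.

Lemma fmap_mono (G : D) (x x' y y' z' : Hom G FA) :
  ole x x' -> ole y y' -> oapp x' y' z' -> exists z, oapp x y z /\ ole z z'.
Proof.
move=> [l [<- l2]] [k [<- k2]] [d [d1 d2 <-]].
rewrite /= in l2 k2 d1 d2 *.
have [P [p [q pb]]] := limC.2 _ _ _ (le_snd A) (app_fst A).
have [_ up] := lexF.2 _ _ _ _ _ _ _ _ pb.
have [h [[hl hd] _]] := up G l d (etrans l2 (esym d1)).
have [Q [r [s pb']]] := limC.2 _ _ _ (le_snd A) (app_snd A ∘ q).
have [_ up'] := lexF.2 _ _ _ _ _ _ _ _ pb'.
have e : fmap F (le_snd A) ∘ k = fmap F (app_snd A ∘ q) ∘ h.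
  by rewrite fmap_comp -comp_assoc hd d2.
have [h' [[hk hh] _]] := up' G k h e.
have := @opas_mono _ A Q (le_fst A ∘ (p ∘ s)) (le_snd A ∘ (p ∘ s))
  (le_fst A ∘ r) (le_snd A ∘ r) (app_val A ∘ (q ∘ s)).
case; [by exists (p ∘ s)|by exists r| |].
  by exists (q ∘ s); split=> //; rewrite !comp_assoc ?pb.1 // pb'.1.
move=> z [[c [c1 c2 c3]] [m [m1 m2]]].
exists (fmap F z ∘ h'); split.
  exists (fmap F c ∘ h'); split; rewrite /= !comp_assoc -!fmap_comp ?c1 ?c2 ?c3 //.
  - by rewrite !fmap_comp -!comp_assoc hh hl.
  - by rewrite !fmap_comp -!comp_assoc hk.
exists (fmap F m ∘ h'); split; rewrite /= !comp_assoc -!fmap_comp ?m1 ?m2 //.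
by rewrite !fmap_comp -!comp_assoc hh hd.
Qed.

Definition fmap_OPAS : OPAS D := MkOPAS fmap_refl fmap_trans fmap_mono.

End ImageOPAS.

End Image.

Lemma regular_epi_epi (C : Category) (X Y : C) (e : Hom X Y) :
  regular_epi e -> forall Z (f g : Hom Y Z), f ∘ e = g ∘ e -> f = g.
Proof.
move=> [K [p [q [epq ue]]]] Z f g efg.
have c : (f ∘ e) ∘ p = (f ∘ e) ∘ q by rewrite -!comp_assoc epq.
by have [h [_ uh]] := ue Z (f ∘ e) c; rewrite -(uh f) // -(uh g).
Qed.

Lemma span_descent (C : Category) (S X Y : C) (a : Hom S X) (b : Hom S Y)
    (D G : C) (e : Hom D G) (x : Hom G X) (y : Hom G Y) (s : Hom D S) :
  jointly_monic a b -> regular_epi e -> a ∘ s = x ∘ e -> b ∘ s = y ∘ e ->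
  exists s' : Hom G S, [/\ a ∘ s' = x, b ∘ s' = y & s' ∘ e = s].
Proof.
move=> jm re ha hb; have [K [p [q [epq ue]]]] := re.
have sc : s ∘ p = s ∘ q.
  by apply: jm; rewrite !comp_assoc ?ha ?hb -!comp_assoc epq.
have [h [hs _]] := ue _ s sc.
exists h; split=> //; apply: (regular_epi_epi re); by rewrite -comp_assoc hs.
Qed.

Section Fibration.
Context {H : Category} (A : OPAS H).

(* The subobject [Y] of [A x X] is presented as a jointly monic span. *)
Record dobj := MkDobj {
  dbase : H;
  dtot : H;
  dreal : Hom dtot A;
  dproj : Hom dtot dbase;
  dmonic : jointly_monic dreal dproj;
  ddown : forall (G : H) (a : Hom G A) (y : Hom G dtot), ole a (dreal ∘ y) ->
    exists y', dreal ∘ y' = a /\ dproj ∘ y' = dproj ∘ y }.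

Definition tracks (U : downset A) (P Q : dobj) (f : Hom (dbase P) (dbase Q)) : Prop :=
  forall (G : H) (u : Hom G A) (y : Hom G (dtot P)), mem U u ->
    exists y' : Hom G (dtot Q),
      oapp u (dreal P ∘ y) (dreal Q ∘ y') /\ dproj Q ∘ y' = f ∘ (dproj P ∘ y).

Variables (regH : regular_category H) (phi : external_filter A) (ccphi : ef_complete phi).

Definition dhom (P Q : dobj) :=
  {f : Hom (dbase P) (dbase Q) | exists U : downset A, phi U /\ tracks U f}.

Lemma id_tracked (P : dobj) : exists U : downset A, phi U /\ tracks U (idm (dbase P)).
Proof.
have [U [pU cU]] := ccphi (PProj ord0 : pterm 1).
exists U; split=> // G u y /cU/(_ G (idm G)) [_].
rewrite comp_idr => /(_ [tuple dreal P ∘ y] (dreal P ∘ y)).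
case; first by rewrite /= (tnth_nth (dreal P ∘ y)).
move=> w [[w' [uw ->]] le]; have [y' [e1 e2]] := ddown le.
by exists y'; rewrite e1 e2 comp_idl.
Qed.

Lemma oapp_comp (D G : H) (x y z : Hom G A) (e : Hom D G) :
  oapp x y z -> oapp (x ∘ e) (y ∘ e) (z ∘ e).
Proof. by move=> [d [<- <- <-]]; exists (d ∘ e); rewrite !comp_assoc. Qed.

Lemma ole_comp (D G : H) (x y : Hom G A) (e : Hom D G) :
  ole x y -> ole (x ∘ e) (y ∘ e).
Proof. by move=> [d [<- <-]]; exists (d ∘ e); rewrite !comp_assoc. Qed.

Lemma oapp_fun (G : H) (x y z z' : Hom G A) : oapp x y z -> oapp x y z' -> z = z'.
Proof.
move=> [d [d1 d2 <-]] [d' [d1' d2' <-]]; congr (_ ∘ _).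
by apply: (app_monic (a := A)); rewrite ?d1 ?d2 ?d1' ?d2'.
Qed.

Lemma mem_comp (X : H) (U : Sub X) (D G : H) (x : Hom G X) (e : Hom D G) :
  mem U x -> mem U (x ∘ e).
Proof. by move=> [y <-]; exists (y ∘ e); rewrite comp_assoc. Qed.

Lemma app_defined_descent (D G : H) (e : Hom D G) (x y : Hom G A) :
  regular_epi e -> (exists z, oapp (x ∘ e) (y ∘ e) z) -> exists z, oapp x y z.
Proof.
move=> re [_ [d [d1 d2 _]]].
have [d' [e1 e2 _]] := span_descent (@app_monic _ A) re d1 d2.
by exists (app_val A ∘ d'), d'.
Qed.

Lemma mem_descent (X : H) (U : Sub X) (D G : H) (e : Hom D G) (x : Hom G X) :
  regular_epi e -> mem U (x ∘ e) -> mem U x.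
Proof.
move=> re [y ye].
have jm : jointly_monic (sub_mono U) (sub_mono U) by move=> Z f g /(@sub_monic _ _ U).
by have [y' [<- _ _]] := span_descent jm re ye ye; exists y'.
Qed.

Lemma tracked_descent (Q : dobj) (D G : H) (e : Hom D G) (w a : Hom G A)
    (x : Hom G (dbase Q)) :
  regular_epi e ->
  (exists y, oapp (w ∘ e) (a ∘ e) (dreal Q ∘ y) /\ dproj Q ∘ y = x ∘ e) ->
  exists y, oapp w a (dreal Q ∘ y) /\ dproj Q ∘ y = x.
Proof.
move=> re [y [[d [d1 d2 d3]] yx]].
have [d' [e1 e2 e3]] := span_descent (@app_monic _ A) re d1 d2.
have yv : dreal Q ∘ y = (app_val A ∘ d') ∘ e by rewrite -comp_assoc e3 d3.
have [y' [f1 f2 _]] := span_descent (@dmonic Q) re yv yx.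
by exists y'; split=> //; exists d'.
Qed.

Lemma ds_app_exists (U V : downset A) : exists W : downset A, is_ds_app U V W.
Proof.
have [_ pbs] := reg_finite_limits regH.
have [P [p [q pb]]] := pbs _ _ _ (app_fst A) (sub_mono U).
have [Q [r [s pb']]] := pbs _ _ _ (app_snd A ∘ p) (sub_mono V).
have [T [l [t pb'']]] := pbs _ _ _ (le_snd A) (app_val A ∘ (p ∘ r)).
have [M [e [m [re mm em]]]] := reg_image regH (le_fst A ∘ l).
have cl : classifies (MkSub mm) (fun G z => locally (fun D (e : Hom D G) =>
    exists x y w, [/\ mem U x, mem V y, oapp x y w & ole (z ∘ e) w])).
  move=> G z; split.
    move=> [y /= <-]; have [K [k [k' pbk]]] := pbs _ _ _ e y.
    exists K, k'; split; first exact: (reg_stable regH pbk re).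
    exists (app_fst A ∘ (p ∘ r ∘ t ∘ k)), (app_snd A ∘ (p ∘ r ∘ t ∘ k)),
      (app_val A ∘ (p ∘ r ∘ t ∘ k)); split.
    - by exists (q ∘ r ∘ t ∘ k); rewrite !comp_assoc pb.1.
    - by exists (s ∘ t ∘ k); rewrite !comp_assoc -pb'.1.
    - by exists (p ∘ r ∘ t ∘ k).
    - exists (l ∘ k); split; last by rewrite !comp_assoc pb''.1 !comp_assoc.
      by rewrite comp_assoc -em -!comp_assoc pbk.1.
  move=> [D [c [rc [x [y [w [[x' ux] [y' vy] [d [d1 d2 d3]] [k [k1 k2]]]]]]]]].
  apply: (mem_descent rc).
  have [h [[h1 _] _]] := pb.2 _ d x' (etrans d1 (esym ux)).
  have [h' [[h1' _] _]] : exists! g, r ∘ g = h /\ s ∘ g = y'.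
    by apply: pb'.2; rewrite -comp_assoc h1 d2 vy.
  have [g [[g1 _] _]] : exists! g, l ∘ g = k /\ t ∘ g = h'.
    by apply: pb''.2; rewrite -!comp_assoc h1' h1 d3 k2.
  by exists (e ∘ g); rewrite /= comp_assoc em -comp_assoc g1 k1.
have dn : forall G (x y : Hom G A), ole x y -> mem (MkSub mm) y -> mem (MkSub mm) x.
  move=> G x y lxy /cl [D [c [rc [a [b [w [ua vb ab le]]]]]]]; apply/cl.
  exists D, c; split=> //; exists a, b, w; split=> //.
  exact: opas_trans (ole_comp c lxy) le.
by exists (MkDownset dn).
Qed.

Lemma comp_tracked (P Q S : dobj) (f : dhom P Q) (g : dhom Q S) :
  exists U : downset A, phi U /\ tracks U (sval g ∘ sval f).
Proof.
case: f g => [f [U [pU tU]]] [g [V [pV tV]]] /=.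
pose t : pterm 3 := PApp (PProj (inord 0)) (PApp (PProj (inord 1)) (PProj (inord 2))).
have [B [pB cB]] := ccphi t.
have [W1 aW1] := ds_app_exists B V.
have BVd : ds_app_defined B V.
  move=> G b v /cB/(_ G (idm G)) [/(_ [tuple v; v])].
  by rewrite comp_idr => -[w [w1 [bv _]]] _ _; exists w1.
have pW1 := ef_app pB pV BVd aW1.
have [W2 aW2] := ds_app_exists W1 U.
have bvu G (w u : Hom G A) : mem W1 w -> locally (fun D (e : Hom D G) =>
    exists b v w', [/\ mem B b, mem V v, oapp b v w', ole (w ∘ e) w' &
      forall D' (e' : Hom D' D), exists z, oapp (w' ∘ e') (u ∘ e ∘ e') z /\
        (forall a x y, oapp (u ∘ e ∘ e') a x -> oapp (v ∘ e') x y ->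
           exists z', oapp z a z' /\ ole z' y)]).
  move=> /aW1 [D [e [re [b [v [w' [mb mv bv le]]]]]]].
  exists D, e; split=> //; exists b, v, w'; split=> // D' e'.
  have [/(_ [tuple v ∘ e'; u ∘ e ∘ e'])] := (cB _ _).1 mb D' e'.
  move=> [_ [w1 [bv1 [z1 [wz _]]]]] real.
  rewrite -(oapp_fun (oapp_comp e' bv) bv1) in wz.
  exists z1; split=> // a x y ua vx.
  have [|w2 [[w3 [bv3 [z3 [wz3 [z4 [za4 /= e4]]]]]] le2]] :=
    real [tuple v ∘ e'; u ∘ e ∘ e'; a] y.
    exists (v ∘ e'), x; split=> //.
      by rewrite /= (tnth_nth a) inordK.
    by exists (u ∘ e ∘ e'), a; split=> //; rewrite /= (tnth_nth a) inordK.
  rewrite -(oapp_fun (oapp_comp e' bv) bv3) in wz3.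
  by rewrite -(oapp_fun wz wz3) in za4; exists z4; rewrite e4 in le2.
have W1Ud : ds_app_defined W1 U.
  move=> G w u mw mu; have [D [e [re [b [v [w' [mb mv bv le K]]]]]]] := bvu G w u mw.
  apply: (app_defined_descent re).
  have [z []] := K _ (idm D); rewrite !comp_idr => wz _.
  by have [z' [wz' _]] := opas_mono le (opas_refl _) wz; exists z'.
have pW2 := ef_app pW1 pU W1Ud aW2.
exists W2; split=> // G w y mw.
have [D [e [re [w1 [u [z [mw1 mu wuz le1]]]]]]] := (aW2 _ _).1 mw.
apply: (tracked_descent re).
have [D' [e' [re' [b [v [w' [mb mv bv le2 K]]]]]]] := bvu D w1 u mw1.
apply: (tracked_descent re').
have [y1 [uy1 py1]] := tU _ u (y ∘ e) mu.
have [y2 [vy2 py2]] := tV _ v (y1 ∘ e') mv.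
have [z1 [wz1 Kz]] := K _ (idm D'); rewrite !comp_idr in wz1 Kz.
have uy1' := oapp_comp e' uy1.
rewrite -[in X in oapp _ _ X]comp_assoc in uy1'.
have [z2 [zz2 le3]] := Kz _ _ _ uy1' vy2.
have [z0 [wz0 le0]] := opas_mono le2 (opas_refl (u ∘ e')) wz1.
rewrite -(oapp_fun (oapp_comp e' wuz) wz0) in le0.
have lez1 := opas_trans (ole_comp e' le1) le0.
have [z3 [wz3 le4]] := opas_mono lez1 (opas_refl _) zz2.
have [y3 [ry3 py3]] := ddown (opas_trans le4 le3).
exists y3; rewrite ry3; split; first by rewrite !comp_assoc in wz3 *.
by rewrite py3 py2 (comp_assoc (dproj Q)) py1 !comp_assoc.
Qed.

Definition dhom_id (P : dobj) : dhom P P := exist _ (idm (dbase P)) (id_tracked P).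

Definition dhom_comp (P Q S : dobj) (g : dhom Q S) (f : dhom P Q) : dhom P S :=
  exist _ (sval g ∘ sval f) (comp_tracked f g).

Lemma dhom_eq (P Q : dobj) (f g : dhom P Q) : sval f = sval g -> f = g.
Proof. by case: f g => [f hf] [g hg] /= e; subst g; congr exist; exact: Prop_irrelevance. Qed.

Program Definition realizability_category : Category :=
  @MkCategory dobj dhom dhom_id dhom_comp _ _ _.
Next Obligation. by apply: dhom_eq; rewrite /= comp_assoc. Qed.
Next Obligation. by apply: dhom_eq; rewrite /= comp_idl. Qed.
Next Obligation. by apply: dhom_eq; rewrite /= comp_idr. Qed.

Definition realizability_fibration : Functor realizability_category H :=
  @MkFunctor realizability_category H dbase (fun P Q f => sval f)
    (fun P => erefl) (fun P Q S g f => erefl).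

(* A choice of the product [A x X] in [H]. *)
Definition const_sig (X : H) :
  {P : H & {p : Hom P A & {q : Hom P X | is_product p q}}} :=
  let s := cid (has_products (reg_finite_limits regH) A X) in
  let s' := cid (projT2 s) in
  existT _ (projT1 s) (existT _ (projT1 s') (cid (projT2 s'))).

Definition const_prod (X : H) : H := projT1 (const_sig X).
Definition const_real (X : H) : Hom (const_prod X) A := projT1 (projT2 (const_sig X)).
Definition const_proj (X : H) : Hom (const_prod X) X :=
  proj1_sig (projT2 (projT2 (const_sig X))).

Lemma const_is_product (X : H) : is_product (const_real X) (const_proj X).
Proof. exact: proj2_sig (projT2 (projT2 (const_sig X))). Qed.

Lemma const_monic (X : H) : jointly_monic (const_real X) (const_proj X).
Proof.
move=> Z f g er ep.
have [h [_ uh]] := const_is_product (const_real X ∘ f) (const_proj X ∘ f).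
by rewrite -(uh f) // -(uh g).
Qed.

Lemma const_down (X G : H) (a : Hom G A) (y : Hom G (const_prod X)) :
  ole a (const_real X ∘ y) ->
  exists y', const_real X ∘ y' = a /\ const_proj X ∘ y' = const_proj X ∘ y.
Proof. by have [h [hh _]] := const_is_product a (const_proj X ∘ y); exists h. Qed.

Definition const_dobj (X : H) : dobj := MkDobj (@const_monic X) (@const_down X).

Lemma const_tracked (X Y : H) (f : Hom X Y) : exists U : downset A,
  phi U /\ tracks (P := const_dobj X) (Q := const_dobj Y) U f.
Proof.
have [U [pU cU]] := ccphi (PProj ord0 : pterm 1).
exists U; split=> // G u y /cU/(_ G (idm G)) [_].
rewrite comp_idr => /(_ [tuple dreal (const_dobj X) ∘ y] (dreal (const_dobj X) ∘ y)).
case; first by rewrite /= (tnth_nth (dreal (const_dobj X) ∘ y)).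
move=> w [[w' [uw _]] _]; rewrite /=.
have [y' [[e1 e2] _]] := const_is_product w' (f ∘ (const_proj X ∘ y)).
by exists y'; rewrite e1 e2.
Qed.

Program Definition const_functor : Functor H realizability_category :=
  @MkFunctor H realizability_category const_dobj
    (fun X Y f => exist _ f (const_tracked f)) _ _.
Next Obligation. exact: dhom_eq. Qed.
Next Obligation. exact: dhom_eq. Qed.

End Fibration.

Definition arrow_class (C : Category) := forall X Y : C, Hom X Y -> Prop.

Section Localization.
Context {C : Category} (W : arrow_class C).

Inductive lexpr : C -> C -> Type :=
  | Larr X Y (f : Hom X Y) : lexpr X Y
  | Linv X Y (w : Hom X Y) (_ : W w) : lexpr Y X
  | Lcomp X Y Z (q : lexpr Y Z) (p : lexpr X Y) : lexpr X Z.

Inductive leqv : forall X Y, lexpr X Y -> lexpr X Y -> Prop :=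
  | leqv_refl X Y (p : lexpr X Y) : leqv p p
  | leqv_sym X Y (p q : lexpr X Y) : leqv p q -> leqv q p
  | leqv_trans X Y (p q r : lexpr X Y) : leqv p q -> leqv q r -> leqv p r
  | leqv_comp X Y Z (q q' : lexpr Y Z) (p p' : lexpr X Y) :
      leqv q q' -> leqv p p' -> leqv (Lcomp q p) (Lcomp q' p')
  | leqv_assoc X Y Z T (r : lexpr Z T) (q : lexpr Y Z) (p : lexpr X Y) :
      leqv (Lcomp r (Lcomp q p)) (Lcomp (Lcomp r q) p)
  | leqv_idl X Y (p : lexpr X Y) : leqv (Lcomp (Larr (idm Y)) p) p
  | leqv_idr X Y (p : lexpr X Y) : leqv (Lcomp p (Larr (idm X))) p
  | leqv_arr X Y Z (g : Hom Y Z) (f : Hom X Y) :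
      leqv (Larr (g ∘ f)) (Lcomp (Larr g) (Larr f))
  | leqv_invl X Y (w : Hom X Y) (Ww : W w) :
      leqv (Lcomp (Linv Ww) (Larr w)) (Larr (idm X))
  | leqv_invr X Y (w : Hom X Y) (Ww : W w) :
      leqv (Lcomp (Larr w) (Linv Ww)) (Larr (idm Y)).

Lemma leqv_equiv (X Y : C) :
  equiv_class_of (fun p q : {classic lexpr X Y} => `[< leqv p q >]).
Proof.
split=> [p|p q|q p r].
- by apply/asboolP; exact: leqv_refl.
- by apply/asboolP/asboolP => /leqv_sym.
- by move=> /asboolP pq /asboolP qr; apply/asboolP; exact: leqv_trans qr.
Qed.

Definition leqv_rel (X Y : C) := EquivRelPack (leqv_equiv X Y).

Definition lhom (X Y : C) : Type := {eq_quot leqv_rel X Y}.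

Definition lpi (X Y : C) (p : lexpr X Y) : lhom X Y :=
  \pi_({eq_quot leqv_rel X Y}) (p : {classic lexpr X Y}).

Definition lrepr (X Y : C) (f : lhom X Y) : lexpr X Y :=
  repr (f : {eq_quot leqv_rel X Y}).

Lemma lpiP (X Y : C) (p q : lexpr X Y) : lpi p = lpi q <-> leqv p q.
Proof.
split; first by move=> /eqmodP /asboolP.
by move=> pq; apply/eqmodP/asboolP.
Qed.

Lemma lreprK (X Y : C) (f : lhom X Y) : lpi (lrepr f) = f.
Proof. exact: reprK. Qed.

Lemma lpi_repr (X Y : C) (p : lexpr X Y) : leqv (lrepr (lpi p)) p.
Proof. by apply/lpiP; rewrite lreprK. Qed.

Definition lcomp (X Y Z : C) (g : lhom Y Z) (f : lhom X Y) : lhom X Z :=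
  lpi (Lcomp (lrepr g) (lrepr f)).

Lemma lcomp_pi (X Y Z : C) (q : lexpr Y Z) (p : lexpr X Y) :
  lcomp (lpi q) (lpi p) = lpi (Lcomp q p).
Proof. by apply/lpiP; apply: leqv_comp; exact: lpi_repr. Qed.

Program Definition localization : Category :=
  @MkCategory C lhom (fun X => lpi (Larr (idm X))) lcomp _ _ _.
Next Obligation.
rewrite -(lreprK h) -(lreprK g) -(lreprK f) !lcomp_pi.
by apply/lpiP; exact: leqv_assoc.
Qed.
Next Obligation.
by rewrite -(lreprK f) !lcomp_pi; apply/lpiP; exact: leqv_idl.
Qed.
Next Obligation.
by rewrite -(lreprK f) !lcomp_pi; apply/lpiP; exact: leqv_idr.
Qed.

Program Definition localization_functor : Functor C localization :=
  @MkFunctor C localization (fun X => X) (fun X Y f => lpi (Larr f)) _ _.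
Next Obligation. by rewrite /= lcomp_pi; apply/lpiP; exact: leqv_arr. Qed.

End Localization.

Definition cocartesian (E B : Category) (p : Functor E B) (X Y : E) (m : Hom X Y) : Prop :=
  forall (Z : E) (g : Hom X Z) (h : Hom (p Y) (p Z)), h ∘ fmap p m = fmap p g ->
    exists! k : Hom Y Z, fmap p k = h /\ k ∘ m = g.

Section Assemblies.
Context {H : Category} (A : OPAS H) (regH : regular_category H).
Variables (phi : external_filter A) (ccphi : ef_complete phi).

Definition supine_monos : arrow_class (realizability_category regH ccphi) :=
  fun P Q m => monic m /\ cocartesian (realizability_fibration regH ccphi) m.

Definition Asm : Category := localization supine_monos.

Definition nabla : Functor H Asm :=
  functor_comp (localization_functor supine_monos) (const_functor regH ccphi).

End Assemblies.

(* Fully faithful functors stand for inclusions of subcategories: [H] is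
   a reflective subcategory of [R], with inclusion [refl_I],
   reflector [refl_R] and unit [refl_unit]. *)
Record lexReflection (R H : Category) := MkLexReflection {
  refl_I : Functor H R;
  refl_R : Functor R H;
  refl_unit : forall X : R, Hom X (refl_I (refl_R X));
  refl_unit_nat : forall (X Y : R) (f : Hom X Y),
    refl_unit Y ∘ f = fmap refl_I (fmap refl_R f) ∘ refl_unit X;
  refl_univ : forall (X : R) (Z : H) (f : Hom X (refl_I Z)),
    exists! g : Hom (refl_R X) Z, fmap refl_I g ∘ refl_unit X = f;
  refl_I_full : full refl_I;
  refl_I_faithful : faithful refl_I;
  refl_I_regular : regular_functor refl_I;
  refl_R_faithful : faithful refl_R;
  refl_R_lex : preserves_finite_limits refl_R }.

Section Prone.
Context {R H : Category} (S : lexReflection R H) (C : OPAS R).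

Definition prone (X Y : R) (f : Hom X Y) : Prop :=
  is_pullback (fmap (refl_I S) (fmap (refl_R S) f)) (refl_unit S Y) (refl_unit S X) f.

(* [f : X -> Y] is a prodo morphism, [c] being the first component of the
   inclusion of [X] into [C x Y]. *)
Definition prodo (X Y : R) (c : Hom X C) (f : Hom X Y) : Prop :=
  (exists P (p : Hom P C) (q : Hom P Y) (h : Hom X P),
     [/\ is_product p q, p ∘ h = c, q ∘ h = f, monic h & prone h]) /\
  (forall (G : R) (a : Hom G C) (x : Hom G X), ole a (c ∘ x) ->
     exists x', c ∘ x' = a /\ f ∘ x' = f ∘ x).

Definition weak_genericity : Prop :=
  forall X : R, exists Y (e : Hom Y X) (p : Hom Y C), regular_epi e /\ prone p.

Definition tracking_prodo : Prop :=
  forall (X Y Z : R) (cX : Hom X C) (e : Hom X Y) (cY : Hom Y C) (f : Hom Y Z),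
    regular_epi e -> prodo cX e -> prodo cY f ->
    exists W (cW : Hom W C) (g : Hom W Z), [/\ regular_epi g, prodo cW g &
      forall P (w : Hom P W) (y : Hom P Y), is_pullback g f w y ->
      forall Q (p : Hom Q P) (x : Hom Q X), is_pullback y e p x ->
      exists s : Hom P Q, p ∘ s = idm P /\ oapp (cW ∘ w) (cY ∘ y) (cX ∘ (x ∘ s))].

Definition tracking_prone : Prop :=
  forall (X Y Z : R) (cX : Hom X C) (e : Hom X Y) (f : Hom Y Z),
    regular_epi e -> prodo cX e -> prone f ->
    exists W (cW : Hom W C) (g : Hom W Z), [/\ regular_epi g, prodo cW g &
      forall P (w : Hom P W) (y : Hom P Y), is_pullback g f w y ->
      forall Q (p : Hom Q P) (x : Hom Q X), is_pullback y e p x ->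
      exists s : Hom P Q, p ∘ s = idm P /\ cX ∘ (x ∘ s) = cW ∘ w].

End Prone.

Section ReflectedOPAS.
Context {R H : Category} (limR : has_finite_limits R) (limH : has_finite_limits H).
Variables (S : lexReflection R H) (C : OPAS R).

Definition reflected_OPAS : OPAS H := fmap_OPAS limR (refl_R_lex S) C.

Definition reincluded_OPAS : OPAS R :=
  fmap_OPAS limH (regf_lex (refl_I_regular S)) reflected_OPAS.

(* [C] is regarded, through the unit, as a subobject of [I R C]. It is
   required to be a filter there and to carry the induced order and application,
   as the generic filter does in a category of assemblies. An unrelated
   structure on [C] would not do: the natural numbers object of the effective
   assemblies, with [x <= y] for all [x], [y] and any total application, satisfies
   weak genericity and tracking, but its downsets carry no information. *)
Record filter_structure : Prop := {
  fs_filter : is_filter (A := reincluded_OPAS)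
    (fun G a => exists x : Hom G C, refl_unit S C ∘ x = a);
  fs_le : forall (G : R) (x y : Hom G C),
    ole (A := reincluded_OPAS) (refl_unit S C ∘ x) (refl_unit S C ∘ y) -> ole x y;
  fs_app : forall (G : R) (x y : Hom G C) (z : Hom G reincluded_OPAS),
    oapp (A := reincluded_OPAS) (refl_unit S C ∘ x) (refl_unit S C ∘ y) z ->
    exists z', oapp x y z' }.

End ReflectedOPAS.

Record regularRealizabilityCategory := MkRegularRealizabilityCategory {
  rrR : Category;
  rrH : Category;
  rr_heyting : heyting_category rrR;
  rr_regular : regular_category rrH;
  rr_refl : lexReflection rrR rrH;
  rrC : OPCA rrR;
  rr_filter : filter_structure (reg_finite_limits (hey_regular rr_heyting))
    (reg_finite_limits rr_regular) rr_refl rrC;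
  rr_weak_genericity : weak_genericity rr_refl rrC;
  rr_tracking_prodo : tracking_prodo rr_refl rrC;
  rr_tracking_prone : tracking_prone rr_refl rrC }.

Definition rrI (X : regularRealizabilityCategory) : Functor (rrH X) (rrR X) :=
  refl_I (rr_refl X).

Definition rrRC (X : regularRealizabilityCategory) : OPAS (rrH X) :=
  reflected_OPAS (reg_finite_limits (hey_regular (rr_heyting X))) (rr_refl X) (rrC X).

(* Main.v *)
From mathcomp Require Import all_boot boolp.
Require Import Defs.

(** An object [X] of [R] is a subobject of [I (L X)], because the reflector [L]
    is faithful; so [R] can be described inside [H], generalized elements
    [D -> I Z] being transposed to arrows [L D -> Z]. The external filter
    consists of the downsets [U] of [L C] such that [I U] meets [C].
    The comparison functor from assemblies to [R] sends [(X, Y)] to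
    [{x in I X | exists c in C, (c, x) in I Y}]. It inverts supine monomorphisms,
    and these admit a calculus of fractions, which yields faithfulness: two
    arrows with the same image are equalized by a restriction of their domain,
    since [L] sends [{(c, x) | c in C, (c, x) in I Y}] back to [Y].
    A map between two such objects is tracked: the tracking principle applied
    to the prone map [{(c, x) | c in C, (c, x) in I Y} -> C] and then to the
    prodo map [C -> 1] gives a single downset of realizers. Essential
    surjectivity is weak genericity together with upward closure of [C]. *)

Set Implicit Arguments.
Unset Strict Implicit.
Unset Printing Implicit Defensive.
Local Open Scope cat_scope.

(** * Categories *)

Section Categories.
Context {C : Category}.

Lemma is_iso_id (X : C) : is_iso (idm X).
Proof. by exists (idm X); rewrite comp_idl. Qed.

Lemma is_iso_comp (X Y Z : C) (g : Hom Y Z) (f : Hom X Y) :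
  is_iso g -> is_iso f -> is_iso (g ∘ f).
Proof.
move=> [g' [g'g gg']] [f' [f'f ff']]; exists (f' ∘ g'); split.
  by rewrite -comp_assoc (comp_assoc g') g'g comp_idl.
by rewrite -comp_assoc (comp_assoc f) ff' comp_idl.
Qed.

Lemma iso_monic (X Y : C) (f : Hom X Y) : is_iso f -> monic f.
Proof.
move=> [g [gf _]] Z a b e.
by rewrite -(comp_idl a) -gf -comp_assoc e comp_assoc gf comp_idl.
Qed.

Lemma monic_comp (X Y Z : C) (g : Hom Y Z) (f : Hom X Y) :
  monic g -> monic f -> monic (g ∘ f).
Proof. by move=> mg mf W a b; rewrite -!comp_assoc => /mg/mf. Qed.

Lemma regular_epi_iso_comp (X Y Z : C) (i : Hom Y Z) (e : Hom X Y) :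
  is_iso i -> regular_epi e -> regular_epi (i ∘ e).
Proof.
move=> [j [ji ij]] [K [p [q [epq ue]]]]; exists K, p, q.
split=> [|W f /ue [h [he hu]]]; first by rewrite -!comp_assoc epq.
exists (h ∘ j); split=> [|h' e']; first by rewrite comp_assoc -(comp_assoc h) ji comp_idr.
by rewrite (hu (h' ∘ i)) -?comp_assoc ?ij ?comp_idr.
Qed.

Lemma regular_epi_id (X : C) : regular_epi (idm X).
Proof.
exists X, (idm X), (idm X); split=> // Z f _; exists f.
by split=> [|h <-]; rewrite comp_idr.
Qed.

Lemma pullback_iso (X Y Z P : C) (f : Hom X Z) (g : Hom Y Z) (p : Hom P X) (q : Hom P Y) :
  is_pullback f g p q -> is_iso g -> is_iso p.
Proof.
move=> [sq up] [j [jg gj]].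
have [h [[ph qh] _]] := up X (idm X) (j ∘ f) ltac:(by rewrite comp_assoc gj comp_idl comp_idr).
exists h; split=> //.
have [k [_ uk]] := up P p q sq.
rewrite -(uk (h ∘ p)) ?(uk (idm P)) ?comp_idr // !comp_assoc ph comp_idl; split=> //.
by rewrite qh -comp_assoc sq comp_assoc jg comp_idl.
Qed.

Lemma pullback_monic (X Y Z P : C) (f : Hom X Z) (g : Hom Y Z) (p : Hom P X) (q : Hom P Y) :
  is_pullback f g p q -> monic f -> monic q.
Proof.
move=> [sq up] mf W a b e.
have pe : p ∘ a = p ∘ b by apply: mf; rewrite !comp_assoc sq -!comp_assoc e.
have [k [_ uk]] : exists! h, p ∘ h = p ∘ b /\ q ∘ h = q ∘ b.
  by apply: up; rewrite !comp_assoc sq.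
by rewrite -(uk a) // -(uk b).
Qed.

Lemma product_jointly_monic (X Y P : C) (p : Hom P X) (q : Hom P Y) :
  is_product p q -> jointly_monic p q.
Proof.
move=> pr Z f g ep eq; have [h [_ uh]] := pr Z (p ∘ f) (q ∘ f).
by rewrite -(uh f) // -(uh g).
Qed.

Hypothesis regC : regular_category C.

Lemma has_pullbacks (X Y Z : C) (f : Hom X Z) (g : Hom Y Z) :
  exists P (p : Hom P X) (q : Hom P Y), is_pullback f g p q.
Proof. exact: (reg_finite_limits regC).2. Qed.

Lemma terminal_cover (T W G : C) (w : Hom W T) : is_terminal T -> regular_epi w ->
  exists D (e : Hom D G) (x : Hom D W), regular_epi e.
Proof.
move=> hT rw; have [t _] := hT G.
have [P [p [q pb]]] := has_pullbacks w t.
by exists P, q, p; exact: (reg_stable regC pb rw).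
Qed.

(** Descending the image factorization of [g ∘ f] along [f] and then along [g] gives a section of
    its monic part, which is therefore invertible. *)
Lemma regular_epi_comp (X Y Z : C) (f : Hom X Y) (g : Hom Y Z) :
  regular_epi f -> regular_epi g -> regular_epi (g ∘ f).
Proof.
move=> rf rg.
have [M [e [m [re mm em]]]] := reg_image regC (g ∘ f).
suff im : is_iso m by rewrite -em; exact: regular_epi_iso_comp.
have jm : jointly_monic m m by move=> U a b /mm.
have [s1 [ms1 _ _]] := span_descent jm rf em em.
have [s2 [ms2 _ _]] := @span_descent C M Z Z m m Y Z g (idm Z) (idm Z) s1 jm rg
  ltac:(by rewrite ms1 comp_idl) ltac:(by rewrite ms1 comp_idl).
exists s2; split=> //.
by apply: mm; rewrite comp_assoc ms2 comp_idl comp_idr.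
Qed.

Lemma sub_meet (X : C) (U V : Sub X) : exists W : Sub X,
  forall G (x : Hom G X), mem W x <-> mem U x /\ mem V x.
Proof.
have [P [p [q pb]]] := has_pullbacks (sub_mono U) (sub_mono V).
have mm := monic_comp (@sub_monic _ _ V) (pullback_monic pb (@sub_monic _ _ U)).
exists (MkSub mm) => G x; split.
  by move=> [y /= <-]; split; [exists (p ∘ y)|exists (q ∘ y)]; rewrite comp_assoc ?pb.1.
move=> [[y <-] [z e]]; have [h [[h1 h2] _]] := pb.2 _ y z (esym e).
by exists h; rewrite /= -comp_assoc h2.
Qed.

End Categories.

(* The inverse image of a relation along [(x, y) : Z -> X x Y]; its universal property is
   stated along [F], because both the identity and the reflector are needed. *)
Lemma lex_span_inverse_image (C D : Category) (F : Functor C D)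
    (limC : has_finite_limits C) (lexF : preserves_finite_limits F)
    (S X Y Z : C) (a : Hom S X) (b : Hom S Y) (x : Hom Z X) (y : Hom Z Y) :
  jointly_monic a b -> exists (T : Sub Z) (s : Hom (sub_ob T) S),
  [/\ a ∘ s = x ∘ sub_mono T, b ∘ s = y ∘ sub_mono T &
    forall (G : D) (z : Hom G (F Z)) (t : Hom G (F S)),
      fmap F a ∘ t = fmap F x ∘ z -> fmap F b ∘ t = fmap F y ∘ z ->
      exists z', fmap F (sub_mono T) ∘ z' = z].
Proof.
move=> jm; have [[T hT] hP] := limC.
have [x0 _] := hT X; have [y0 _] := hT Y.
have [P [p [q pb]]] := hP _ _ _ x0 y0.
have [m [[m1 m2] _]] := pb.2 S a b (terminal_eq _ _ hT).
have [n [[n1 n2] _]] := pb.2 Z x y (terminal_eq _ _ hT).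
have mm : monic m by move=> W f g e; apply: jm; rewrite -?m1 -?m2 -!comp_assoc e.
have [Q [r [s pb']]] := hP _ _ _ m n.
exists (MkSub (pullback_monic pb' mm)), r; split=> /=.
- by rewrite -m1 -comp_assoc pb'.1 comp_assoc n1.
- by rewrite -m2 -comp_assoc pb'.1 comp_assoc n2.
move=> G z t e1 e2.
have Fpb := lexF.2 _ _ _ _ _ _ _ _ pb.
have [k [_ uk]] := Fpb.2 G (fmap F a ∘ t) (fmap F b ∘ t) (terminal_eq _ _ (lexF.1 _ hT)).
have [] := (lexF.2 _ _ _ _ _ _ _ _ pb').2 G t z.
  rewrite -(uk (fmap F m ∘ t)); last by rewrite !comp_assoc -!fmap_comp m1 m2.
  by apply: uk; rewrite !comp_assoc -!fmap_comp n1 n2 e1 e2.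
by move=> h [[_ h2] _]; exists h.
Qed.

(** * Inverting a fully faithful, essentially surjective functor *)

Section Equivalence.
Context {H C D : Category} (F : Functor H C) (G : Functor H D) (P : Functor D C).
Hypotheses (fullP : full P) (faithP : faithful P).
Hypothesis esoP : forall X : C, exists (Y : D) (f : Hom (P Y) X), is_iso f.
Hypothesis PG : nat_iso (functor_comp P G) F.

Let eob X := proj1_sig (cid (@esoP X)).
Let ef X : Hom (P (eob X)) X := proj1_sig (cid (proj2_sig (cid (@esoP X)))).
Let ef_iso X : is_iso (ef X) := proj2_sig (cid (proj2_sig (cid (@esoP X)))).
Let eg X : Hom X (P (eob X)) := proj1_sig (cid (ef_iso X)).

Let egf X : eg X ∘ ef X = idm _.
Proof. exact: (proj2_sig (cid (ef_iso X))).1. Qed.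

Let efg X : ef X ∘ eg X = idm _.
Proof. exact: (proj2_sig (cid (ef_iso X))).2. Qed.

Let pre (X Y : D) (g : Hom (P X) (P Y)) : Hom X Y := proj1_sig (cid (fullP g)).

Let preK (X Y : D) (g : Hom (P X) (P Y)) : fmap P (pre g) = g.
Proof. exact: proj2_sig (cid (fullP g)). Qed.

Let emap X Y (f : Hom X Y) : Hom (eob X) (eob Y) := pre (eg Y ∘ f ∘ ef X).

Let emap_id X : emap (idm X) = idm (eob X).
Proof. by apply: faithP; rewrite preK comp_idr egf fmap_id. Qed.

Let emap_comp X Y Z (g : Hom Y Z) (f : Hom X Y) : emap (g ∘ f) = emap g ∘ emap f.
Proof.
apply: faithP; rewrite fmap_comp !preK !comp_assoc -(comp_assoc _ (ef Y)) efg.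
by rewrite comp_idr.
Qed.

Let E : Functor C D := MkFunctor emap_id emap_comp.

Let pre_iso (X Y : D) (f : Hom X Y) : is_iso (fmap P f) -> is_iso f.
Proof.
move=> [g [gf fg]]; exists (pre g).
by split; apply: faithP; rewrite fmap_comp preK fmap_id.
Qed.

(** The comparison functor will run from assemblies to the realizability category, opposite to the
    direction that [equivalent_under] asks for; chosen preimages along [P] turn it round. *)
Lemma equivalent_under_of_inverse : equivalent_under F G.
Proof.
have [t [ti tn]] := PG.
exists E; split; first exists P; [split|].
- exists ef; split=> // X Y f.
  by rewrite /= preK !comp_assoc efg comp_idl.
- exists (fun Y => pre (ef (P Y))); split=> [Y|X Y f].
    by apply: pre_iso; rewrite preK; exact: ef_iso.
  by apply: faithP; rewrite !fmap_comp !preK !comp_assoc efg comp_idl.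
exists (fun X => pre (proj1_sig (cid (ti X)) ∘ ef (F X))); split=> [X|X Y f].
  apply: pre_iso; rewrite preK; apply: is_iso_comp (ef_iso _).
  by case: cid => s /= [s1 s2]; exists (t X).
apply: faithP; rewrite !fmap_comp !preK !comp_assoc.
rewrite -(comp_assoc _ (ef (F Y))) efg comp_idr; congr (_ ∘ _).
case: cid => s /= [s1 s2]; case: cid => s' /= [s1' s2'].
rewrite -[RHS]comp_idl -s1 -!comp_assoc (comp_assoc (t Y)) [t Y ∘ _]tn.
by rewrite -!comp_assoc s2' comp_idr.
Qed.

End Equivalence.

(** * Functors out of a localization *)

Section LocalizationLift.
Context {C D : Category} (W : arrow_class C) (F : Functor C D).
Hypothesis FW : forall X Y (w : Hom X Y), W w -> is_iso (fmap F w).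

Fixpoint leval (X Y : C) (p : lexpr W X Y) : Hom (F X) (F Y) :=
  match p with
  | Larr _ _ f => fmap F f
  | Linv _ _ _ Ww => proj1_sig (cid (FW Ww))
  | Lcomp _ _ _ q p => leval q ∘ leval p
  end.

Lemma leval_eqv (X Y : C) (p q : lexpr W X Y) : leqv p q -> leval p = leval q.
Proof.
elim=> //= {X Y p q}.
- by move=> X Y p q r _ -> _ ->.
- by move=> X Y Z q q' p p' _ -> _ ->.
- by move=> *; rewrite comp_assoc.
- by move=> *; rewrite fmap_id comp_idl.
- by move=> *; rewrite fmap_id comp_idr.
- by move=> *; rewrite fmap_comp.
- by move=> X Y w Ww; case: cid => s /= [-> _]; rewrite fmap_id.
- by move=> X Y w Ww; case: cid => s /= [_ ->]; rewrite fmap_id.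
Qed.

Lemma leval_repr (X Y : C) (p : lexpr W X Y) : leval (lrepr (lpi p)) = leval p.
Proof. exact/leval_eqv/lpi_repr. Qed.

Program Definition localization_lift : Functor (localization W) D :=
  @MkFunctor (localization W) D F (fun X Y f => leval (lrepr f)) _ _.
Next Obligation. by rewrite leval_repr /= fmap_id. Qed.
Next Obligation. by rewrite leval_repr. Qed.

End LocalizationLift.

(** * Reflections *)

Section Reflection.
Context {R H : Category} (S : lexReflection R H).
Notation I := (refl_I S).
Notation L := (refl_R S).
Notation η := (refl_unit S).

Definition transpose (X : R) (Z : H) (f : Hom X (I Z)) : Hom (L X) Z :=
  proj1_sig (cid (refl_univ f)).

Lemma transposeK (X : R) (Z : H) (f : Hom X (I Z)) : fmap I (transpose f) ∘ η X = f.
Proof. exact: (proj2_sig (cid (refl_univ f))).1. Qed.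

Lemma transpose_unique (X : R) (Z : H) (f : Hom X (I Z)) (g : Hom (L X) Z) :
  fmap I g ∘ η X = f -> transpose f = g.
Proof. exact: (proj2_sig (cid (refl_univ f))).2. Qed.

Lemma transpose_inj (X : R) (Z : H) (f g : Hom (L X) Z) :
  fmap I f ∘ η X = fmap I g ∘ η X -> f = g.
Proof. by move=> e; rewrite -(transpose_unique e) (transpose_unique (erefl (fmap I g ∘ _))). Qed.

Lemma transpose_comp (X Y : R) (Z : H) (f : Hom Y (I Z)) (g : Hom X Y) :
  transpose (f ∘ g) = transpose f ∘ fmap L g.
Proof.
by apply: transpose_unique; rewrite fmap_comp -comp_assoc -refl_unit_nat comp_assoc transposeK.
Qed.

Lemma transpose_fmap (X : R) (Z Z' : H) (g : Hom Z Z') (f : Hom X (I Z)) :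
  transpose (fmap I g ∘ f) = g ∘ transpose f.
Proof. by apply: transpose_unique; rewrite fmap_comp -comp_assoc transposeK. Qed.

Lemma transpose_unit (X : R) : transpose (η X) = idm (L X).
Proof. by apply: transpose_unique; rewrite fmap_id comp_idl. Qed.

Definition counit (Z : H) : Hom (L (I Z)) Z := transpose (idm (I Z)).

Lemma transpose_counit (X : R) (Z : H) (f : Hom X (I Z)) :
  transpose f = counit Z ∘ fmap L f.
Proof. by rewrite -transpose_comp comp_idl. Qed.

(** By fullness of [I] the unit at [I Z] is [fmap I k], and [k] inverts the counit. *)
Lemma counit_iso (Z : H) : is_iso (counit Z).
Proof.
have [k ek] := refl_I_full (η (I Z)).
have ck : counit Z ∘ k = idm Z.
  by apply: (refl_I_faithful (l := S)); rewrite fmap_comp ek transposeK fmap_id.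
exists k; split=> //; apply: transpose_inj.
by rewrite fmap_comp -comp_assoc transposeK ek fmap_id comp_idl comp_idr.
Qed.

(** By naturality [η X ∘ f] determines [fmap L f], and [L] is faithful. *)
Lemma unit_monic (X : R) : monic (η X).
Proof.
move=> Z f g e; apply: (refl_R_faithful (l := S)).
by apply: transpose_inj; rewrite -!refl_unit_nat.
Qed.

Lemma fmapL_unit_iso (X : R) : is_iso (fmap L (η X)).
Proof.
have [k [kc ck]] := counit_iso (L X).
have e : counit (L X) ∘ fmap L (η X) = idm _ by rewrite -transpose_counit transpose_unit.
by exists (counit (L X)); split=> //; rewrite -[fmap L _]comp_idl -kc -(comp_assoc k) e comp_idr.
Qed.

(** [L] is a left adjoint: a coequalizing map is transposed, factored through [e] in [R], and
    transposed back. *)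
Lemma fmapL_regular_epi (X Y : R) (e : Hom X Y) : regular_epi e -> regular_epi (fmap L e).
Proof.
move=> [K [p [q [epq ue]]]]; exists (L K), (fmap L p), (fmap L q).
split=> [|Z f efg]; first by rewrite -!fmap_comp epq.
have [|k [ke uk]] := ue _ (fmap I f ∘ η X).
  by rewrite -!comp_assoc !refl_unit_nat !comp_assoc -!fmap_comp efg.
exists (transpose k); split=> [|h eh].
  by rewrite -transpose_comp ke; exact: transpose_unique.
apply: transpose_unique; symmetry; apply: uk.
by rewrite -comp_assoc refl_unit_nat comp_assoc -fmap_comp eh.
Qed.

(** The pullback condition transposed: prone arrows are the Cartesian arrows of [L]. Uniqueness of
    the lift comes from faithfulness of [L]. *)
Lemma proneP (X Y : R) (f : Hom X Y) :
  prone S f <-> forall (D : R) (y : Hom D Y) (x : Hom (L D) (L X)),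
    fmap L f ∘ x = fmap L y -> exists t : Hom D X, fmap L t = x.
Proof.
split=> [[_ up] D y x e|P].
  have [|t [[t1 t2] _]] := up D (fmap I x ∘ η D) y.
    by rewrite comp_assoc -fmap_comp e refl_unit_nat.
  by exists t; apply: transpose_inj; rewrite -refl_unit_nat.
split=> [|D a y e]; first by rewrite refl_unit_nat.
have [|t et] := P D y (transpose a).
  by apply: transpose_inj; rewrite fmap_comp -comp_assoc transposeK e refl_unit_nat.
exists t; split; last first.
  by move=> t' [e1 _]; apply: unit_monic; rewrite e1 refl_unit_nat et transposeK.
split; first by rewrite refl_unit_nat et transposeK.
by apply: unit_monic; rewrite -e comp_assoc refl_unit_nat -comp_assoc refl_unit_nat et transposeK.
Qed.

Lemma transpose_monic (X : R) (Z : H) (f : Hom X (I Z)) (limR : has_finite_limits R) :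
  monic f -> monic (transpose f).
Proof.
move=> mf; rewrite transpose_counit; apply: monic_comp (iso_monic (counit_iso _)) _.
exact: fmap_monic (refl_R_lex S) _ _ _ mf.
Qed.

Hypothesis regR : regular_category R.

(** The Cartesian lift is the pullback of [fmap I g] along the unit; [L] preserves this pullback and
    inverts the unit. *)
Lemma prone_lift (X : R) (Z : H) (g : Hom Z (L X)) :
  exists E (p : Hom E X) (e : Hom (L E) Z), [/\ prone S p, is_iso e & g ∘ e = fmap L p].
Proof.
have [E [y [p pb]]] := has_pullbacks regR (fmap I g) (η X).
have iy : is_iso (transpose y).
  rewrite transpose_counit; apply: is_iso_comp (counit_iso _) _.
  exact: pullback_iso ((refl_R_lex S).2 _ _ _ _ _ _ _ _ pb) (fmapL_unit_iso _).
have ey : g ∘ transpose y = fmap L p.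
  by rewrite -transpose_fmap pb.1 transpose_comp transpose_unit comp_idl.
exists E, p, (transpose y); split=> //; apply/proneP => D x z e.
have [|t [[t1 t2] _]] := pb.2 D (fmap I (transpose y ∘ z) ∘ η D) x.
  by rewrite comp_assoc -fmap_comp comp_assoc ey e refl_unit_nat.
exists t; apply: (iso_monic iy); apply: transpose_inj.
by rewrite -t1 fmap_comp -comp_assoc -refl_unit_nat comp_assoc transposeK.
Qed.

Lemma transpose_image (E : R) (X : H) (g : Hom (L E) X) :
  exists F (q : Hom E F) (i : Hom (L F) X),
    [/\ regular_epi q, monic i & i ∘ fmap L q = g].
Proof.
have [F [q [m [rq mm em]]]] := reg_image regR (fmap I g ∘ η E).
exists F, q, (transpose m); split=> //.
  exact: transpose_monic (reg_finite_limits regR) mm.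
by rewrite -transpose_comp em; exact: transpose_unique.
Qed.

(** The monic [i] makes [F] a subobject of [I X], and membership in a subobject can be checked on a
    regular epic cover. *)
Lemma transpose_descent (X : H) (F : R) (i : Hom (L F) X) (D G : R) (e : Hom D G)
    (x : Hom (L G) X) (s : Hom D F) :
  monic i -> regular_epi e -> i ∘ fmap L s = x ∘ fmap L e ->
  exists t : Hom G F, i ∘ fmap L t = x.
Proof.
move=> mi re es; have [K [p [q [epq ue]]]] := re.
have [|t [te _]] := ue _ s.
  apply: (refl_R_faithful (l := S)); apply: mi.
  by rewrite !fmap_comp !comp_assoc es -!comp_assoc -!fmap_comp epq.
exists t; apply: (regular_epi_epi (fmapL_regular_epi re)).
by rewrite -comp_assoc -fmap_comp te.
Qed.

Lemma fmapL_pair (T X Y P : R) (x : Hom X T) (y : Hom Y T) (p : Hom P X) (q : Hom P Y)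
    (G : H) (a : Hom G (L X)) (b : Hom G (L Y)) :
  is_terminal T -> is_pullback x y p q ->
  exists h : Hom G (L P), fmap L p ∘ h = a /\ fmap L q ∘ h = b.
Proof.
move=> hT pb; have [_ up] := (refl_R_lex S).2 _ _ _ _ _ _ _ _ pb.
have [|h [hh _]] := up G a b; last by exists h.
exact: (terminal_eq _ _ ((refl_R_lex S).1 _ hT)).
Qed.

(** The second clause makes every pair of elements in [H] an instance of the generic pair living in
    [R]. *)
Lemma product_exists (X Y : R) : exists P (p : Hom P X) (q : Hom P Y),
  is_product p q /\ forall (G : H) (a : Hom G (L X)) (b : Hom G (L Y)),
    exists h : Hom G (L P), fmap L p ∘ h = a /\ fmap L q ∘ h = b.
Proof.
have [[T hT] _] := reg_finite_limits regR.
have [x _] := hT X; have [y _] := hT Y.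
have [P [p [q pb]]] := has_pullbacks regR x y.
exists P, p, q; split=> [Z a b|G a b]; last exact: fmapL_pair hT pb.
by apply: pb.2; exact: terminal_eq hT.
Qed.

End Reflection.
Arguments proneP {R H S X Y} f.

(** * The external filter *)

Section Algebra.
Context {R H : Category} (limR : has_finite_limits R) (limH : has_finite_limits H).
Variables (S : lexReflection R H) (C : OPAS R).
Notation I := (refl_I S).
Notation L := (refl_R S).
Notation A := (reflected_OPAS limR S C).

Lemma fmapL_ole (G : R) (x y : Hom G C) :
  ole x y -> ole (A := A) (fmap L x) (fmap L y).
Proof. by move=> [l [<- <-]]; exists (fmap L l); rewrite /= -!fmap_comp. Qed.

Lemma fmapL_oapp (G : R) (x y z : Hom G C) :
  oapp x y z -> oapp (A := A) (fmap L x) (fmap L y) (fmap L z).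
Proof. by move=> [d [<- <- <-]]; exists (fmap L d); rewrite /= -!fmap_comp. Qed.

Hypothesis fsC : filter_structure limR limH S C.

(** This is closure of [C] under application inside [I (L C)], transposed along the adjunction. *)
Lemma filter_app (G : R) (u v : Hom G C) (z : Hom (L G) A) :
  oapp (A := A) (fmap L u) (fmap L v) z -> exists w : Hom G C, fmap L w = z.
Proof.
move=> [d [d1 d2 d3]].
have [|||w ew] := (fs_filter fsC).1 G (refl_unit S C ∘ u) (refl_unit S C ∘ v)
    (fmap I z ∘ refl_unit S G).
- by exists u.
- by exists v.
- exists (fmap I d ∘ refl_unit S G); rewrite /= !refl_unit_nat !comp_assoc -!fmap_comp.
  by rewrite -d1 -d2 -d3.
by exists w; apply: (transpose_inj (S := S)); rewrite -refl_unit_nat.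
Qed.

Lemma filter_up (G : R) (u : Hom G C) (z : Hom (L G) A) :
  ole (A := A) (fmap L u) z -> exists w : Hom G C, fmap L w = z.
Proof.
move=> [d [d1 d2]].
have [||w ew] := (fs_filter fsC).2 G (refl_unit S C ∘ u) (fmap I z ∘ refl_unit S G).
- by exists u.
- exists (fmap I d ∘ refl_unit S G); rewrite /= refl_unit_nat !comp_assoc -!fmap_comp.
  by rewrite -d1 -d2.
by exists w; apply: (transpose_inj (S := S)); rewrite -refl_unit_nat.
Qed.

Hypothesis regR : regular_category R.
Hypothesis regH : regular_category H.

(* [U] is in the filter when [I U] meets [C]; the intersection is computed
   stagewise, after transposing along the adjunction. *)
Definition meets (U : downset A) : Prop :=
  forall G : R, locally (fun D (_ : Hom D G) => exists c : Hom D C, mem U (fmap L c)).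

Lemma meets_up (U V : downset A) : meets U -> sub_le U V -> meets V.
Proof.
move=> mU [y ey] G; have [D [e [re [c [x ex]]]]] := mU G.
by exists D, e; split=> //; exists c, (y ∘ x); rewrite comp_assoc ey.
Qed.

Lemma locally_pair (G : R) (P Q : forall D, Hom D C -> Prop) :
  (forall D D' (e : Hom D' D) c, P D c -> P D' (c ∘ e)) ->
  locally (fun D (_ : Hom D G) => exists c, P D c) ->
  (forall D, locally (fun D' (_ : Hom D' D) => exists c, Q D' c)) ->
  locally (fun D (_ : Hom D G) => exists c c', P D c /\ Q D c').
Proof.
move=> st [D [e [re [c Pc]]]] /(_ D) [D' [e' [re' [c' Qc]]]].
exists D', (e ∘ e'); split; first exact: regular_epi_comp.
by exists (c ∘ e'), c'; split=> //; exact: st.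
Qed.

Lemma meets_app (U V W : downset A) : meets U -> meets V -> ds_app_defined U V ->
  is_ds_app U V W -> meets W.
Proof.
move=> mU mV dUV aW G.
have [D [e [re [c [c' [mc mc']]]]]] := locally_pair
  (P := fun D c => mem U (fmap L c)) (Q := fun D c => mem V (fmap L c))
  ltac:(by move=> D D' e c /=; rewrite fmap_comp; exact: mem_comp) (mU G) mV.
exists D, e; split=> //.
have [z uz] := dUV _ _ _ mc mc'.
have [w ew] := filter_app uz; exists w; apply/aW.
exists (L D), (idm (L D)); split; first exact: regular_epi_id.
exists (fmap L c), (fmap L c'), z; split=> //.
by rewrite comp_idr ew; exact: opas_refl.
Qed.

Definition generic_filter : external_filter A := MkExternalFilter meets_up meets_app.

(** A cover of [I G] in [R] reflects to a cover of [L (I G)], which the counit identifies with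
    [G]. *)
Lemma meets_inhabited (U : downset A) (G : H) : meets U ->
  locally (fun D (_ : Hom D G) => exists u : Hom D A, mem U u).
Proof.
move=> /(_ (I G)) [D [e [re [c mc]]]].
exists (L D), (counit S G ∘ fmap L e); split; last by exists (fmap L c).
apply: regular_epi_iso_comp; [exact: counit_iso|exact: fmapL_regular_epi].
Qed.

End Algebra.

(** * From assemblies to the realizability category *)

Section Extent.
Context {R H : Category} (limR : has_finite_limits R) (limH : has_finite_limits H).
Variables (S : lexReflection R H) (C : OPAS R).
Notation L := (refl_R S).
Notation A := (reflected_OPAS limR S C).
Hypothesis fsC : filter_structure limR limH S C.
Hypotheses (regR : regular_category R) (regH : regular_category H).
Notation chi := (generic_filter fsC regR).

(* For [P = (X, Y)], [ext_ob] is the subobject [{x in I X | exists c in C, (c, x) in I Y}],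
   and [ext_tot] is [{(c, x) in C x I X | (c, x) in I Y}]; the reflector sends
   the latter to [Y]. *)
Record extent (P : dobj A) := MkExtent {
  ext_tot : R;
  ext_real : Hom ext_tot C;
  ext_cmp : Hom (L ext_tot) (dtot P);
  ext_ob : R;
  ext_epi : Hom ext_tot ext_ob;
  ext_incl : Hom (L ext_ob) (dbase P);
  ext_cmp_iso : is_iso ext_cmp;
  ext_prone : prone S ext_real;
  ext_regular : regular_epi ext_epi;
  ext_monic : monic ext_incl;
  ext_realE : dreal P ∘ ext_cmp = fmap L ext_real;
  ext_inclE : ext_incl ∘ fmap L ext_epi = dproj P ∘ ext_cmp }.

Lemma extent_exists (P : dobj A) : exists _ : extent P, True.
Proof.
have [E [p [e [pp ie ep]]]] := prone_lift regR (dreal P : Hom _ (L C)).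
have [F [q [i [rq mi iq]]]] := transpose_image regR (dproj P ∘ e).
by exists (MkExtent ie pp rq mi ep iq).
Qed.

Definition ext (P : dobj A) : extent P := proj1_sig (cid (extent_exists P)).

Lemma ext_lift (P : dobj A) (D : R) (c : Hom D C) (y : Hom (L D) (dtot P)) :
  dreal P ∘ y = fmap L c ->
  exists t : Hom D (ext_tot (ext P)),
    ext_real (ext P) ∘ t = c /\ ext_cmp (ext P) ∘ fmap L t = y.
Proof.
have [j [jc cj]] := ext_cmp_iso (ext P); move=> e.
have [|t et] := (proneP _).1 (ext_prone (ext P)) D c (j ∘ y).
  by rewrite -ext_realE -comp_assoc (comp_assoc _ j) cj comp_idl.
exists t; rewrite et comp_assoc cj comp_idl; split=> //.
apply: (refl_R_faithful (l := S)).
by rewrite fmap_comp -ext_realE et -comp_assoc (comp_assoc _ j) cj comp_idl.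
Qed.

Lemma ext_jointly_monic (P : dobj A) : jointly_monic (ext_real (ext P)) (ext_epi (ext P)).
Proof.
move=> D t t' er ee; apply: (refl_R_faithful (l := S)).
apply: (iso_monic (ext_cmp_iso (ext P))); apply: (@dmonic _ _ P).
  by rewrite !comp_assoc ext_realE -!fmap_comp er.
by rewrite !comp_assoc -ext_inclE -!comp_assoc -!fmap_comp ee.
Qed.

Definition in_ext (P : dobj A) (D : R) (x : Hom (L D) (dbase P)) : Prop :=
  exists t : Hom D (ext_ob (ext P)), ext_incl (ext P) ∘ fmap L t = x.

Lemma ext_unique (P : dobj A) (D : R) (t t' : Hom D (ext_ob (ext P))) :
  ext_incl (ext P) ∘ fmap L t = ext_incl (ext P) ∘ fmap L t' -> t = t'.
Proof. by move=> /(@ext_monic _ (ext P))/(refl_R_faithful (l := S)). Qed.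

(** Kripke-Joyal reading of the existential quantifier that defines [ext_ob]: pulling back [ext_epi]
    gives the cover, and a local witness lifts to [ext_tot] and descends. *)
Lemma in_extP (P : dobj A) (D : R) (x : Hom (L D) (dbase P)) :
  in_ext x <-> locally (fun D' (e : Hom D' D) => exists (c : Hom D' C) (y : Hom (L D') (dtot P)),
    dreal P ∘ y = fmap L c /\ dproj P ∘ y = x ∘ fmap L e).
Proof.
split=> [[t <-]|[D' [e [re [c [y [yc yx]]]]]]].
  have [D' [t' [e pb]]] := has_pullbacks regR (ext_epi (ext P)) t.
  exists D', e; split; first exact: (reg_stable regR pb (ext_regular _)).
  exists (ext_real (ext P) ∘ t'), (ext_cmp (ext P) ∘ fmap L t').
  rewrite comp_assoc ext_realE fmap_comp; split=> //.
  by rewrite comp_assoc -ext_inclE -!comp_assoc -!fmap_comp pb.1.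
have [t [tc ty]] := ext_lift yc.
apply: (transpose_descent (s := ext_epi (ext P) ∘ t) (@ext_monic _ _) re).
by rewrite fmap_comp comp_assoc ext_inclE -comp_assoc ty yx.
Qed.

(** A local element [u] of [U] in [C] sends a realizer [c] in [C] to [u c], which stays in [C] by
    closure under application. *)
Lemma tracks_in_ext (P Q : dobj A) (U : downset A) (f : Hom (dbase P) (dbase Q))
    (D : R) (x : Hom (L D) (dbase P)) :
  meets U -> tracks U f -> in_ext x -> in_ext (f ∘ x).
Proof.
move=> mU tU /in_extP [D' [e [re [c [y [yc yx]]]]]]; apply/in_extP.
have [D'' [e' [re' [u mu]]]] := mU D'.
exists D'', (e ∘ e'); split; first exact: regular_epi_comp.
have [y' [ay py]] := tU _ (fmap L u) (y ∘ fmap L e') mu.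
rewrite comp_assoc yc -fmap_comp in ay.
have [w ew] := filter_app fsC ay.
exists w, y'; split=> //.
by rewrite py comp_assoc (comp_assoc _ y) -(comp_assoc f) yx fmap_comp !comp_assoc.
Qed.

Hypothesis cchi : ef_complete chi.
Notation RC := (realizability_category regH cchi).

Lemma ext_map_exists (P Q : RC) (f : Hom P Q) :
  exists t : Hom (ext_ob (ext P)) (ext_ob (ext Q)),
    ext_incl (ext Q) ∘ fmap L t = sval f ∘ ext_incl (ext P).
Proof.
have [U [mU tU]] := svalP f.
apply: (tracks_in_ext mU tU); exists (idm _).
by rewrite fmap_id comp_idr.
Qed.

Definition ext_map (P Q : RC) (f : Hom P Q) : Hom (ext_ob (ext P)) (ext_ob (ext Q)) :=
  proj1_sig (cid (ext_map_exists f)).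

Lemma ext_mapE (P Q : RC) (f : Hom P Q) :
  ext_incl (ext Q) ∘ fmap L (ext_map f) = sval f ∘ ext_incl (ext P).
Proof. exact: proj2_sig (cid (ext_map_exists f)). Qed.

Program Definition extent_functor : Functor RC R :=
  @MkFunctor RC R (fun P => ext_ob (ext P)) ext_map _ _.
Next Obligation. by apply: ext_unique; rewrite ext_mapE fmap_id comp_idl comp_idr. Qed.
Next Obligation.
by apply: ext_unique; rewrite ext_mapE fmap_comp comp_assoc ext_mapE -!comp_assoc ext_mapE.
Qed.

(** * Supine monomorphisms *)

Notation W := (@supine_monos H A regH chi cchi).

(** Realizers [u] of the identity function track such an inclusion: [u a] lies below [a], and the
    relation of [Q] is downward closed. *)
Lemma dhom_of_incl (P Q : RC) (f : Hom (dbase P) (dbase Q)) (t : Hom (dtot P) (dtot Q)) :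
  dreal Q ∘ t = dreal P -> dproj Q ∘ t = f ∘ dproj P -> exists g : Hom P Q, sval g = f.
Proof.
have [U [pU cU]] := cchi (PProj ord0 : pterm 1).
move=> rt pt; suff tU : tracks U f by exists (exist _ f (ex_intro _ U (conj pU tU))).
move=> G u y /cU/(_ G (idm G)) [_].
rewrite comp_idr => /(_ [tuple dreal P ∘ y] (dreal P ∘ y)).
case; first by rewrite /= (tnth_nth (dreal P ∘ y)).
move=> w [[w' [uw ->]] le].
have [|y' [e1 e2]] := @ddown _ _ Q G w' (t ∘ y); first by rewrite comp_assoc rt.
by exists y'; rewrite e1 e2 comp_assoc pt comp_assoc.
Qed.

(** To apply monicity of [m], the object [Z] of [H] is given the largest relation for which [f] and
    [g] both preserve realizers: the intersection of the reindexings of [P] along them. *)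
Lemma sval_monic (P Q : RC) (m : Hom P Q) : monic m -> monic (sval m).
Proof.
move=> mm Z f g efg.
(* [U] is the reindexing of [P] along [h], a subobject of [A x Z]. *)
have cl (h : Hom Z (dbase P)) : exists U : Sub (const_prod A regH Z), forall G z,
    mem U z <-> exists y : Hom G (dtot P),
      dreal P ∘ y = const_real A regH Z ∘ z /\ dproj P ∘ y = h ∘ const_proj A regH Z ∘ z.
  have [U [s [s1 s2 Us]]] := lex_span_inverse_image (F := functor_id H)
    (reg_finite_limits regH) ltac:(by split) (const_real A regH Z)
    (h ∘ const_proj A regH Z) (@dmonic _ _ P).
  exists U => G z; split; last by move=> [y [y1 y2]]; exact: (Us _ z y y1 y2).
  by move=> [z' <-]; exists (s ∘ z'); rewrite !comp_assoc s1 s2.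
have [U hU] := cl f; have [V hV] := cl g.
have [T hT] := sub_meet regH U V.
have jm : jointly_monic (const_real A regH Z ∘ sub_mono T) (const_proj A regH Z ∘ sub_mono T).
  move=> G x y; rewrite -!comp_assoc => e1 e2.
  exact/(@sub_monic _ _ T)/(const_monic e1 e2).
have dn (G : H) (a : Hom G A) (y : Hom G (sub_ob T)) :
    ole a (const_real A regH Z ∘ sub_mono T ∘ y) ->
    exists y', const_real A regH Z ∘ sub_mono T ∘ y' = a /\
      const_proj A regH Z ∘ sub_mono T ∘ y' = const_proj A regH Z ∘ sub_mono T ∘ y.
  rewrite -!comp_assoc => le.
  have [z [z1 z2]] := const_down le.
  have /hT [/hU [y1 [r1 p1]] /hV [y2 [r2 p2]]] : mem T (sub_mono T ∘ y) by exists y.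
  have [|y1' [r1' p1']] := @ddown _ _ P G a y1; first by rewrite r1.
  have [|y2' [r2' p2']] := @ddown _ _ P G a y2; first by rewrite r2.
  have /hT [z' ez'] : mem U z /\ mem V z.
    split; [apply/hU; exists y1'|apply/hV; exists y2'].
      by rewrite r1' z1 p1' p1 -!comp_assoc z2.
    by rewrite r2' z1 p2' p2 -!comp_assoc z2.
  by exists z'; rewrite -!comp_assoc ez'.
pose O : RC := MkDobj jm dn.
have /hT [/hU [tf [rf pf]] /hV [tg [rg pg]]] : mem T (sub_mono T).
  by exists (idm _); rewrite comp_idr.
have [f' ef] := @dhom_of_incl O P f tf rf ltac:(by rewrite pf comp_assoc).
have [g' eg] := @dhom_of_incl O P g tg rg ltac:(by rewrite pg comp_assoc).
suff e : f' = g' by rewrite -ef -eg e.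
by apply: mm; apply: dhom_eq; rewrite /= ef eg.
Qed.

Section Restrict.
Variables (P : RC) (X : H) (m : Hom X (dbase P)) (q : Hom (dtot P) X).
Hypotheses (mm : monic m) (mq : m ∘ q = dproj P).

Lemma restrict_monic : jointly_monic (dreal P) q.
Proof.
by move=> Z f g e1 e2; apply: (@dmonic _ _ P) => //; rewrite -mq -!comp_assoc e2.
Qed.

Lemma restrict_down (G : H) (a : Hom G A) (y : Hom G (dtot P)) : ole a (dreal P ∘ y) ->
  exists y', dreal P ∘ y' = a /\ q ∘ y' = q ∘ y.
Proof.
move=> /(@ddown _ _ P) [y' [e1 e2]]; exists y'; split=> //.
by apply: mm; rewrite !comp_assoc mq.
Qed.

Definition restrict : RC := MkDobj restrict_monic restrict_down.

(** Only the base shrinks and the realizers are unchanged, so a downset tracking a map out of the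
    restriction also tracks its extension to [P]. *)
Lemma restrict_supine : exists m' : Hom restrict P, sval m' = m /\ W m'.
Proof.
have [m' em'] := @dhom_of_incl restrict P m (idm _) (comp_idr _)
  ltac:(by rewrite comp_idr mq).
exists m'; split=> //; split=> [T f g e|T g h e].
  by apply: dhom_eq; apply: mm; rewrite -em'; exact: (congr1 sval e).
rewrite /= in h e *; rewrite em' in e.
have [U [mU tU]] := svalP g.
have tU' : tracks (P := P) U h.
  move=> G u y mu; have [y' [ay' py']] := tU G u y mu.
  by exists y'; split=> //; rewrite py' -mq -e !comp_assoc.
exists (exist _ h (ex_intro _ U (conj mU tU'))); split.
  by split=> //; apply: dhom_eq; rewrite /= em'.
by move=> k [ek _]; apply: dhom_eq.
Qed.

End Restrict.

Section DirectImage.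
Variables (P : RC) (X : H) (m : Hom (dbase P) X) (mm : monic m).

Lemma direct_image_monic : jointly_monic (dreal P) (m ∘ dproj P).
Proof. by move=> Z f g e1; rewrite -!comp_assoc => /mm; exact: (@dmonic _ _ P). Qed.

Lemma direct_image_down (G : H) (a : Hom G A) (y : Hom G (dtot P)) : ole a (dreal P ∘ y) ->
  exists y', dreal P ∘ y' = a /\ m ∘ dproj P ∘ y' = m ∘ dproj P ∘ y.
Proof.
by move=> /(@ddown _ _ P) [y' [e1 e2]]; exists y'; rewrite -!comp_assoc e2.
Qed.

Definition direct_image : RC := MkDobj direct_image_monic direct_image_down.

End DirectImage.

(** As [m] is coCartesian, the evident map from [P] to its direct image extends along [m]. Thus
    realizers in [Q] are uniformly turned into realizers in [P] of a preimage. *)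
Lemma supine_back (P Q : RC) (m : Hom P Q) (Wm : W m) :
  exists k : Hom Q (direct_image (sval_monic Wm.1)), sval k = idm (dbase Q).
Proof.
pose Z := direct_image (sval_monic Wm.1).
have [g eg] := @dhom_of_incl P Z (sval m) (idm _) (comp_idr _) (comp_idr _).
by have [k [[ek _] _]] := Wm.2 Z g (idm _) ltac:(by rewrite /= comp_idl); exists k.
Qed.

(** The inverse comes from [supine_back]: a local element of [C] tracking [k] turns a realizer in
    [C] of a point of [Q] into one of its preimage in [P]. *)
Lemma extent_supine (P Q : RC) (m : Hom P Q) : W m -> is_iso (fmap extent_functor m).
Proof.
move=> Wm; have ms := sval_monic Wm.1; have [k ek] := supine_back Wm.
have [U [mU bU]] := svalP k; rewrite ek in bU.
have mt : monic (sval m ∘ ext_incl (ext P)) := monic_comp ms (@ext_monic _ _).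
have [s es] : exists s : Hom (ext_ob (ext Q)) (ext_ob (ext P)),
    sval m ∘ ext_incl (ext P) ∘ fmap L s = ext_incl (ext Q).
  have /in_extP [D [e [re [c [y [yc yx]]]]]] : in_ext (ext_incl (ext Q)).
    by exists (idm _); rewrite fmap_id comp_idr.
  have [D' [e' [re' [u mu]]]] := mU D.
  have [y' [ay' py']] := bU _ (fmap L u) (y ∘ fmap L e') mu.
  rewrite comp_assoc yc -fmap_comp in ay'.
  have [w ew] := filter_app fsC ay'.
  have [t [tw ty]] := @ext_lift P D' w y' (esym ew).
  apply: (transpose_descent (s := ext_epi (ext P) ∘ t) mt (regular_epi_comp regR re' re)).
  rewrite -comp_assoc fmap_comp (comp_assoc (ext_incl _)) ext_inclE -(comp_assoc _ _ (fmap L t)) ty.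
  by rewrite comp_assoc [LHS]py' comp_idl comp_assoc yx fmap_comp !comp_assoc.
exists s; split; rewrite /=.
  apply: (refl_R_faithful (l := S)); apply: mt.
  by rewrite fmap_comp comp_assoc es ext_mapE fmap_id comp_idr.
by apply: ext_unique; rewrite fmap_comp comp_assoc ext_mapE es fmap_id comp_idr.
Qed.

(** * Calculus of fractions *)

(** [P'] is the restriction of [P] to the pullback of [sval n] along [sval f]; this contains the
    support of [P] because [supine_back] supplies preimages in [Q1]. *)
Lemma ore (P Q Q1 : RC) (f : Hom P Q) (n : Hom Q1 Q) : W n ->
  exists P' (m : Hom P' P) (f' : Hom P' Q1), W m /\ n ∘ f' = f ∘ m.
Proof.
move=> Wn; have ms := sval_monic Wn.1; have [k ek] := supine_back Wn.
have [U [mU tU]] := svalP (k ∘ f); rewrite /= ek comp_idl in tU.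
have [X [x1 [x2 pb]]] := has_pullbacks regH (sval n) (sval f).
have mx := pullback_monic pb ms.
have [q eq] : mem (MkSub mx) (dproj P).
  (* [U] has elements only locally, hence the descent along [e]. *)
  have [D [e [re [u mu]]]] := meets_inhabited (dtot P) mU.
  apply: (mem_descent re); have [y' [_ py']] := tU D u e mu.
  have [|t [[_ t2] _]] := pb.2 D (dproj Q1 ∘ y') (dproj P ∘ e).
    by rewrite comp_assoc; exact: py'.
  by exists t.
have [m [em Wm]] := restrict_supine mx eq.
pose P' := restrict mx eq.
have tf : tracks (P := P') (Q := Q1) U x1.
  move=> G u y mu; have [y' [ay' py']] := tU G u y mu; exists y'; split=> //.
  apply: ms; rewrite comp_assoc [LHS]py' -eq (comp_assoc (sval n)) pb.1.
  by rewrite !comp_assoc.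
exists P', m, (exist _ x1 (ex_intro _ U (conj mU tf))); split=> //.
by apply: dhom_eq; rewrite /= em pb.1.
Qed.

(** The arrows agree on the support of [P], which the restriction to their equalizer contains. *)
Lemma ext_map_inj (P Q : RC) (f g : Hom P Q) : ext_map f = ext_map g ->
  exists P' (m : Hom P' P), W m /\ f ∘ m = g ∘ m.
Proof.
move=> efg.
(* [T] is the equalizer, obtained as the inverse image of the diagonal. *)
have [T [s [s1 s2 hT]]] := lex_span_inverse_image (F := functor_id H)
  (reg_finite_limits regH) ltac:(by split) (sval f) (sval g)
  (a := idm (dbase Q)) (b := idm (dbase Q))
  ltac:(by move=> Z x y; rewrite !comp_idl).
(* Up to the isomorphism [ext_cmp], [dproj P] factors through [ext_incl], where equality of the
   extents forces agreement. *)
have ed : sval f ∘ dproj P = sval g ∘ dproj P.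
  have [j [_ cj]] := ext_cmp_iso (ext P).
  rewrite -[dproj P]comp_idr -cj (comp_assoc (dproj P)) -ext_inclE !comp_assoc.
  by rewrite -!ext_mapE efg.
have [|q eq] := hT _ (dproj P) (sval f ∘ dproj P) (comp_idl _).
  by rewrite ed; exact: comp_idl.
have [m [em Wm]] := restrict_supine (@sub_monic _ _ T) eq.
exists (restrict (@sub_monic _ _ T) eq), m; split=> //.
by apply: dhom_eq; rewrite /= em -s1 -s2.
Qed.

Lemma supine_comp (P Q Q' : RC) (n : Hom Q Q') (m : Hom P Q) : W n -> W m -> W (n ∘ m).
Proof.
move=> [mn cn] [mm cm]; split; first exact: monic_comp.
move=> Z g h e.
have [k1 [[e1 f1] u1]] := cm Z g (h ∘ fmap (realizability_fibration regH cchi) n)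
  ltac:(by rewrite -comp_assoc -fmap_comp).
have [k2 [[e2 f2] u2]] := cn Z k1 h (esym e1).
exists k2; split=> [|k [ek fk]]; first by rewrite comp_assoc f2.
by apply: u2; split=> //; symmetry; apply: u1; rewrite fmap_comp ek -comp_assoc.
Qed.

Notation arr f := (lpi (Larr W f)).

Lemma arr_comp (P Q Z : RC) (g : Hom Q Z) (f : Hom P Q) :
  lcomp (arr g) (arr f) = arr (g ∘ f).
Proof. by rewrite lcomp_pi; apply/lpiP/leqv_sym/leqv_arr. Qed.

Lemma lcomp_assoc (P Q Z Z' : RC) (h : lhom W Z Z') (g : lhom W Q Z) (f : lhom W P Q) :
  lcomp h (lcomp g f) = lcomp (lcomp h g) f.
Proof. exact: (@comp_assoc (localization W)). Qed.

(** A formal inverse is cancelled by the arrow it inverts; in a composite, [ore] moves the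
    denominator of [q] past the numerator of [p]. *)
Lemma fraction (P Q : RC) (p : lexpr W P Q) : exists P' (m : Hom P' P) (f : Hom P' Q),
  W m /\ lcomp (lpi p) (arr m) = arr f.
Proof.
have W_id X : W (idm X).
  split=> [Z f g|Z g h]; first by rewrite !comp_idl.
  rewrite fmap_id comp_idr => ->; exists g; split; first by rewrite comp_idr.
  by move=> k [_]; rewrite comp_idr.
elim: p => {P Q} [P Q f|P Q w Ww|P Q Z q [Q' [n [g [Wn eg]]]] p [P' [m [f [Wm ef]]]]].
- by exists P, (idm P), f; split=> //; rewrite arr_comp comp_idr.
- exists P, w, (idm P); split=> //; rewrite lcomp_pi; apply/lpiP; exact: leqv_invl.
have [P'' [m' [f' [Wm' e]]]] := ore f Wn.
exists P'', (m ∘ m'), (g ∘ f'); split; first exact: supine_comp.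
rewrite -[lpi _]lcomp_pi -!arr_comp -eg -!lcomp_assoc (lcomp_assoc (lpi p)) ef.
by rewrite !arr_comp e.
Qed.

Lemma arr_iso (P Q : RC) (m : Hom P Q) : W m -> is_iso (arr m : @Hom (localization W) P Q).
Proof.
move=> Wm; exists (lpi (Linv Wm)).
by split; rewrite [LHS]lcomp_pi; apply/lpiP; [exact: leqv_invl|exact: leqv_invr].
Qed.

Definition asm_extent : Functor (localization W) R := localization_lift extent_supine.

Lemma asm_extent_arr (P Q : RC) (f : Hom P Q) : fmap asm_extent (arr f) = ext_map f.
Proof. exact: (leval_repr extent_supine (Larr W f)). Qed.

(** [ore] gives a common denominator; the numerators then have equal extents, so they agree after
    one more supine monomorphism, and the total denominator is invertible. *)
Lemma asm_extent_faithful : faithful asm_extent.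
Proof.
move=> P Q p q epq.
have [P1 [m [f [Wm ef]]]] := fraction (lrepr p).
have [P2 [n [g [Wn eg]]]] := fraction (lrepr q).
rewrite !lreprK in ef eg.
have [P3 [m' [n' [Wm' e]]]] := ore m Wn.
have ef' : (p : @Hom (localization W) P Q) ∘ arr (m ∘ m') = arr (f ∘ m').
  by rewrite -!arr_comp -ef; exact: comp_assoc.
have eg' : (q : @Hom (localization W) P Q) ∘ arr (m ∘ m') = arr (g ∘ n').
  by rewrite -e -!arr_comp -eg; exact: comp_assoc.
have [|P4 [d [Wd ed]]] := @ext_map_inj _ _ (f ∘ m') (g ∘ n').
  by rewrite -!asm_extent_arr -ef' -eg' !fmap_comp epq.
have [i [_ mi]] := arr_iso (supine_comp (supine_comp Wm Wm') Wd).
rewrite -[LHS]comp_idr -[RHS]comp_idr -mi !comp_assoc; congr (_ ∘ _).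
rewrite -arr_comp [LHS]comp_assoc [RHS]comp_assoc ef' eg'.
by rewrite [LHS]arr_comp ed [RHS]arr_comp.
Qed.

(** * Fullness from the tracking principle *)

(** [V] consists of the [(b, c, x)] with [b], [c] in [C] such that [b] realizes [h x] and [c]
    realizes [x]; over fixed [(c, x)] the admissible [b] form a downset. *)
Lemma prodo_pullback (P Q : RC) (h : Hom (ext_ob (ext P)) (ext_ob (ext Q)))
    (V : R) (v1 : Hom V (ext_tot (ext Q))) (v2 : Hom V (ext_tot (ext P))) :
  is_pullback (ext_epi (ext Q)) (h ∘ ext_epi (ext P)) v1 v2 ->
  prodo S (ext_real (ext Q) ∘ v1) v2.
Proof.
move=> pb; split; last first.
  move=> G a x; rewrite -comp_assoc => /(fmapL_ole limR S).
  rewrite fmap_comp -ext_realE -comp_assoc => /(@ddown _ _ Q) [y [ya yx]].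
  have [t [ta ty]] := ext_lift ya.
  have [|x' [[x1 x2] _]] := pb.2 G t (v2 ∘ x).
    rewrite comp_assoc -pb.1 -comp_assoc; apply: ext_unique.
    rewrite !fmap_comp !comp_assoc !ext_inclE -comp_assoc ty.
    by rewrite yx fmap_comp !comp_assoc.
  by exists x'; rewrite -comp_assoc x1 x2.
have [B [p [q [pr _]]]] := product_exists S regR C (ext_tot (ext P)).
have [k [[k1 k2] _]] := pr V (ext_real (ext Q) ∘ v1) v2.
have mk : monic k.
  move=> D t t' e; have e2 : v2 ∘ t = v2 ∘ t' by rewrite -k2 -!comp_assoc e.
  have e1 : v1 ∘ t = v1 ∘ t'.
    apply: ext_jointly_monic; first by rewrite !comp_assoc -k1 -!comp_assoc e.
    by rewrite !comp_assoc pb.1 -!comp_assoc e2.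
  have [r [_ ur]] := pb.2 D (v1 ∘ t') (v2 ∘ t') ltac:(by rewrite !comp_assoc pb.1).
  by rewrite -(ur t) // -(ur t').
exists B, p, q, k; split=> //; apply/proneP => D y x e.
have e1 : dreal Q ∘ (ext_cmp (ext Q) ∘ fmap L v1 ∘ x) = fmap L (p ∘ y).
  by rewrite !comp_assoc ext_realE -fmap_comp -k1 !fmap_comp -!comp_assoc e.
have [t [tp tx]] := ext_lift e1.
have e2 : fmap L (q ∘ y) = fmap L v2 ∘ x by rewrite fmap_comp -e comp_assoc -fmap_comp k2.
have [|z [[z1 z2] _]] := pb.2 D t (q ∘ y).
  have e3 : fmap L (h ∘ ext_epi (ext P) ∘ (q ∘ y)) =
      fmap L (ext_epi (ext Q)) ∘ (fmap L v1 ∘ x).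
    by rewrite fmap_comp e2 !comp_assoc -!fmap_comp pb.1.
  by apply: ext_unique; rewrite e3 fmap_comp !comp_assoc ext_inclE -comp_assoc tx !comp_assoc.
exists z; apply: (fmap_monic (refl_R_lex S) mk).
rewrite e -fmap_comp; congr (fmap L _).
apply: (product_jointly_monic pr); first by rewrite comp_assoc k1 -comp_assoc z1 tp.
by rewrite comp_assoc k2 z2.
Qed.

(** The splitting of the tracking principle, evaluated at the element [(w, y)] of the pullback. *)
Lemma prone_element (X Y Z : R) (cX : Hom X C) (e : Hom X Y) (f : Hom Y Z) :
  tracking_prone S C -> regular_epi e -> prodo S cX e -> prone S f ->
  exists W (cW : Hom W C) (g : Hom W Z), [/\ regular_epi g, prodo S cW g &
    forall (D : R) (w : Hom D W) (y : Hom D Y), g ∘ w = f ∘ y ->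
    exists x : Hom D X, e ∘ x = y /\ cX ∘ x = cW ∘ w].
Proof.
move=> tr re pe pf; have [W' [cW [g [rg pg tg]]]] := tr X Y Z cX e f re pe pf.
exists W', cW, g; split=> // D w y ewy.
have [B [b1 [b2 pb]]] := has_pullbacks regR g f.
have [B' [q1 [q2 pb']]] := has_pullbacks regR b2 e.
have [s [s1 s2]] := tg _ _ _ pb _ _ _ pb'.
have [t [[t1 t2] _]] := pb.2 D w y ewy.
exists (q2 ∘ s ∘ t); rewrite !comp_assoc -pb'.1 -(comp_assoc b2) s1 comp_idr t2; split=> //.
by rewrite -(comp_assoc cX) s2 -comp_assoc t1.
Qed.

Lemma prodo_element (X Y Z : R) (cX : Hom X C) (e : Hom X Y) (cY : Hom Y C) (f : Hom Y Z) :
  tracking_prodo S C -> regular_epi e -> prodo S cX e -> prodo S cY f ->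
  exists W (cW : Hom W C) (g : Hom W Z), [/\ regular_epi g, prodo S cW g &
    forall (D : R) (w : Hom D W) (y : Hom D Y), g ∘ w = f ∘ y ->
    exists x : Hom D X, e ∘ x = y /\ oapp (cW ∘ w) (cY ∘ y) (cX ∘ x)].
Proof.
move=> tr re pe pf; have [W' [cW [g [rg pg tg]]]] := tr X Y Z cX e cY f re pe pf.
exists W', cW, g; split=> // D w y ewy.
have [B [b1 [b2 pb]]] := has_pullbacks regR g f.
have [B' [q1 [q2 pb']]] := has_pullbacks regR b2 e.
have [s [s1 s2]] := tg _ _ _ pb _ _ _ pb'.
have [t [[t1 t2] _]] := pb.2 D w y ewy.
exists (q2 ∘ s ∘ t); rewrite !comp_assoc -pb'.1 -(comp_assoc b2) s1 comp_idr t2; split=> //.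
have := oapp_comp t s2.
by rewrite -!comp_assoc t1 t2.
Qed.

Lemma prodo_terminal (T : R) (t : Hom C T) : is_terminal T -> prodo S (idm C) t.
Proof.
move=> hT; split=> [|G a x le]; last first.
  by exists a; rewrite comp_idl; split=> //; exact: terminal_eq hT.
exists C, (idm C), t, (idm C); split; rewrite ?comp_idl ?comp_idr //.
- move=> Z a b; exists a; split=> [|x [<- _]]; last by rewrite comp_idl.
  by rewrite comp_idl; split=> //; exact: terminal_eq hT.
- exact: iso_monic (is_iso_id _).
by apply/proneP => D y x; rewrite fmap_id comp_idl => ->; exists y.
Qed.

(** Over a terminal object a prodo morphism is a downset of [C], and its regular epicness is
    inhabitation; [U] is the reflection of this downset. *)
Lemma downset_of_prodo (T W' : R) (cW : Hom W' C) (g : Hom W' T) : is_terminal T ->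
  regular_epi g -> prodo S cW g ->
  exists U : downset A, meets U /\
    forall (G : H) (u : Hom G A), mem U u -> exists w : Hom G (L W'), fmap L cW ∘ w = u.
Proof.
move=> hT rg [[B [p [q [k [pr k1 k2 mk _]]]]] down].
have mc : monic cW.
  move=> D x y e; apply: mk; apply: (product_jointly_monic pr); last exact: terminal_eq hT.
  by rewrite !comp_assoc k1.
have mL := fmap_monic (refl_R_lex S) mc.
have dn (G : H) (x y : Hom G A) : ole x y -> mem (MkSub mL) y -> mem (MkSub mL) x.
  move=> [l [<- l2]] [w /= ew].
  (* Downward closure is applied in [R] to the universal inequality below an element of [W']; [L]
     preserves this pullback, so every instance in [H] comes from it. *)
  have [V [l' [w' pb]]] := has_pullbacks regR (le_snd C) cW.
  have [_ up] := (refl_R_lex S).2 _ _ _ _ _ _ _ _ pb.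
  have [z [[z1 z2] _]] := up G l w (etrans l2 (esym ew)).
  have [|x' [ex _]] := down V (le_fst C ∘ l') w'; first by exists l'; rewrite pb.1.
  by exists (fmap L x' ∘ z); rewrite /= comp_assoc -fmap_comp ex fmap_comp -comp_assoc z1.
exists (MkDownset dn); split=> [G|G u [w ew]]; last by exists w.
have [D [e [x re]]] := terminal_cover regR G hT rg.
by exists D, e; split=> //; exists (cW ∘ x), (fmap L x); rewrite fmap_comp.
Qed.

(** The dependence of the realizer is removed in two steps: first on the point [x], by prone
    tracking, then on its realizer [c], by prodo tracking over the terminal object. *)
Lemma tracking_realizer (P Q : RC) (h : Hom (ext_ob (ext P)) (ext_ob (ext Q))) :
  tracking_prodo S C -> tracking_prone S C ->
  exists U : downset A, meets U /\
    forall (G : H) (u : Hom G A) (z : Hom G (L (ext_tot (ext P)))), mem U u ->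
    exists y' : Hom G (dtot Q), oapp u (fmap L (ext_real (ext P)) ∘ z) (dreal Q ∘ y') /\
      dproj Q ∘ y' = ext_incl (ext Q) ∘ (fmap L h ∘ (fmap L (ext_epi (ext P)) ∘ z)).
Proof.
move=> tprodo tprone.
have [V [v1 [v2 pbV]]] := has_pullbacks regR (ext_epi (ext Q)) (h ∘ ext_epi (ext P)).
have rv := reg_stable regR pbV (ext_regular _).
(* An element of [W1] over [c] gives a [b] that realizes [h x] for every [x] realized by [c]. *)
have [W1 [c1 [g1 [rg1 pg1 t1]]]] :=
  prone_element tprone rv (prodo_pullback pbV) (ext_prone (ext P)).
have [[T hT] _] := reg_finite_limits regR.
have [t _] := hT C.
(* An element of [W2] gives an [a] such that [a c] is defined and lies in the fibre of [W1] over
   [c], for every [c] in [C]. *)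
have [W2 [c2 [g2 [rg2 pg2 t2]]]] := prodo_element tprodo rg1 pg1 (prodo_terminal t hT).
have [U [mU hU]] := downset_of_prodo hT rg2 pg2.
exists U; split=> // G u z /hU [w ew].
(* Tracking is established in [R] for the generic pair over [B] and carried by [L] to [(w, z)]. *)
have [B [b1 [b2 [_ pB]]]] := product_exists S regR W2 (ext_tot (ext P)).
have [i [i1 i2]] := pB G w z.
have [x1 [ex1 ax1]] := t2 B b1 (ext_real (ext P) ∘ b2) (terminal_eq _ _ hT).
have [x2 [ex2 ax2]] := t1 B x1 b2 ex1.
exists (ext_cmp (ext Q) ∘ fmap L (v1 ∘ x2) ∘ i); split.
  move: (oapp_comp i (fmapL_oapp limR S ax1)); rewrite -ax2 comp_idl.
  rewrite !fmap_comp !comp_assoc ext_realE -!comp_assoc i1 i2.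
  by rewrite ew.
rewrite !comp_assoc -ext_inclE -(comp_assoc _ (fmap L _) (fmap L (v1 ∘ x2))) -fmap_comp.
rewrite (comp_assoc (ext_epi _)) pbV.1 -(comp_assoc _ v2) ex2 !fmap_comp.
by rewrite -!comp_assoc i2.
Qed.

(** As [h] lives only on the extent, it yields a tracked arrow on the restriction of [P] to base
    [L (ext_ob (ext P))]; the preimage is the fraction of this arrow by the restriction. *)
Lemma asm_extent_full : tracking_prodo S C -> tracking_prone S C -> full asm_extent.
Proof.
move=> tprodo tprone P Q h.
have [j [jc cj]] := ext_cmp_iso (ext P).
have [U [mU tU]] := tracking_realizer (P := P) (Q := Q) h tprodo tprone.
have mq : ext_incl (ext P) ∘ (fmap L (ext_epi (ext P)) ∘ j) = dproj P.
  by rewrite comp_assoc ext_inclE -comp_assoc cj comp_idr.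
pose P' := restrict (@ext_monic _ (ext P)) mq.
have [m [em Wm]] := restrict_supine (@ext_monic _ (ext P)) mq.
have tf : tracks (P := P') (Q := Q) U (ext_incl (ext Q) ∘ fmap L h).
  move=> G u y mu; have [y' [ay' py']] := tU G u (j ∘ y) mu; exists y'.
  rewrite -ext_realE -comp_assoc (comp_assoc _ j) cj comp_idl in ay'.
  by split=> //; rewrite [LHS]py' /= !comp_assoc.
pose f : @Hom RC P' Q := exist _ _ (ex_intro _ U (conj mU tf)).
exists (lpi (Lcomp (Larr W f) (Linv Wm))).
have em' : ext_incl (ext (P' : RC)) = fmap L (ext_map m).
  by apply: (@ext_monic _ (ext P)); rewrite ext_mapE em.
have ef : ext_map f = h ∘ ext_map m.
  by apply: ext_unique; rewrite ext_mapE em' fmap_comp !comp_assoc.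
rewrite [LHS]leval_repr /=; case: cid => s /= [_ ms].
by rewrite ef -comp_assoc ms comp_idr.
Qed.

(** * Essential surjectivity and constant objects *)

Lemma transpose_cover (Y Z : H) (q : Hom Y Z) (D : R) (z : Hom (L D) Z) :
  regular_epi q ->
  exists (D' : R) (d : Hom D' D) (y : Hom (L D') Y), regular_epi d /\ q ∘ y = z ∘ fmap L d.
Proof.
move=> /(regf_epi (refl_I_regular S)) rq.
have [D' [y [d pb]]] :=
  has_pullbacks regR (fmap (refl_I S) q) (fmap (refl_I S) z ∘ refl_unit S D).
exists D', d, (transpose y); split; first exact: (reg_stable regR pb rq).
rewrite -transpose_fmap pb.1 transpose_comp; congr (_ ∘ _); exact: transpose_unique.
Qed.

(** [P] is the relation [{(a, x) in A x L X | exists y in L Y, a <= p y and e y = x}] of the weakly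
    generic span, and its extent is [X]. *)
Lemma asm_extent_eso : weak_genericity S C ->
  forall X : R, exists (P : localization W) (f : Hom (asm_extent P) X), is_iso f.
Proof.
move=> wg X; have [Y [e [p [re pp]]]] := wg X.
have [Y1 [l [y pb]]] := has_pullbacks regH (le_snd A) (fmap L p).
have [n [[n1 n2] _]] := const_is_product regH (le_fst A ∘ l) (fmap L e ∘ y).
have [M [q [m [rq mm em]]]] := reg_image regH n.
have jm : jointly_monic (const_real A regH (L X) ∘ m) (const_proj A regH (L X) ∘ m).
  by move=> G f g; rewrite -!comp_assoc => e1 e2; exact/mm/(const_monic e1 e2).
have dn (G : H) (a : Hom G A) (x : Hom G M) : ole a (const_real A regH (L X) ∘ m ∘ x) ->
    exists x', const_real A regH (L X) ∘ m ∘ x' = a /\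
      const_proj A regH (L X) ∘ m ∘ x' = const_proj A regH (L X) ∘ m ∘ x.
  rewrite -!comp_assoc => le; have [z [z1 z2]] := const_down le.
  (* Membership in the image is checked on a cover carrying a witness [y], where transitivity of the
     order suffices. *)
  have [x' ex'] : mem (MkSub mm) z.
    have [D [x1 [d pbd]]] := has_pullbacks regH q x.
    have rd := reg_stable regH pbd rq; apply: (mem_descent rd).
    have emx : m ∘ x ∘ d = n ∘ x1 by rewrite -comp_assoc -pbd.1 comp_assoc em.
    have := ole_comp d le; rewrite -!comp_assoc (comp_assoc m) emx comp_assoc n1.
    move=> le'; have le2 : ole (A := A) (le_fst A ∘ l ∘ x1) (le_snd A ∘ l ∘ x1).
      by exists (l ∘ x1); rewrite !comp_assoc.
    have [l' [l1 l2]] := opas_trans le' le2.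
    have [|k [[k1 k2] _]] := pb.2 D l' (y ∘ x1).
      by rewrite [LHS]l2 pb.1 comp_assoc.
    exists (q ∘ k); rewrite /= comp_assoc em; apply: const_monic.
      by rewrite !comp_assoc n1 z1 -comp_assoc k1.
    rewrite (comp_assoc _ n) n2 -comp_assoc k2 (comp_assoc _ z) z2.
    by rewrite -(comp_assoc _ _ d) emx !comp_assoc n2.
  by rewrite /= in ex'; exists x'; rewrite -!comp_assoc ex'.
pose P : RC := MkDobj jm dn.
have [f ef] : exists f : Hom (ext_ob (ext P)) X, idm _ ∘ fmap L f = ext_incl (ext P).
  have /in_extP [D [d [rd [c [x [xc xd]]]]]] : in_ext (ext_incl (ext P)).
    by exists (idm _); rewrite fmap_id comp_idr.
  have [D' [d' [y1 [rd' ey1]]]] := transpose_cover x rq.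
  have emx : m ∘ x ∘ fmap L d' = n ∘ y1 by rewrite -comp_assoc -ey1 comp_assoc em.
  (* From [c <= p y] with [c] in [C], upward closure puts [p y] in [C]; proneness of [p] then lifts
     [y] to an element of [Y]. *)
  have [w ew] : exists w : Hom D' C, fmap L w = fmap L p ∘ (y ∘ y1).
    apply: (filter_up fsC (u := c ∘ d')).
    exists (l ∘ y1); rewrite fmap_comp -xc !comp_assoc; split; last by rewrite pb.1.
    by rewrite -n1 /= -!comp_assoc (comp_assoc m) emx.
  have [t et] := (proneP p).1 pp D' w (y ∘ y1) (esym ew).
  apply: (transpose_descent (s := e ∘ t) (iso_monic (is_iso_id _))
    (regular_epi_comp regR rd' rd)).
  rewrite fmap_comp et comp_idl fmap_comp comp_assoc -n2 comp_assoc -xd /=.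
  by rewrite -!comp_assoc (comp_assoc m) emx.
rewrite comp_idl in ef.
(* Conversely, [e y] is realized by [p y], which lies in [C], by reflexivity of the order. *)
have [s es] : in_ext (P := P) (idm (L X)).
  apply/in_extP; exists Y, e; split=> //.
  have [l0 [l1 l2]] := opas_refl (fmap L p : Hom (L Y) A).
  have [k [[k1 k2] _]] := pb.2 _ l0 (idm _) ltac:(by rewrite comp_idr).
  exists p, (q ∘ k); rewrite /= !comp_assoc -!(comp_assoc _ m q) em n1 n2.
  by rewrite -!comp_assoc k1 k2 comp_idl comp_idr.
exists P, f, s; split.
  by apply: ext_unique; rewrite fmap_comp comp_assoc es comp_idl ef fmap_id comp_idr.
by apply: (refl_R_faithful (l := S)); rewrite fmap_comp ef fmap_id.
Qed.

(** Everything realizes a point of a constant object, so its extent is all of [I X] once [C] has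
    local elements; a member of the filter supplies these. *)
Lemma asm_extent_nabla : nat_iso (functor_comp asm_extent (nabla regH cchi)) (refl_I S).
Proof.
exists (fun X => fmap (refl_I S) (ext_incl (ext (const_dobj A regH X))) ∘ refl_unit S _).
split=> [X|X Y f]; last first.
  rewrite /= -comp_assoc [leval _ _](asm_extent_arr).
  by rewrite refl_unit_nat !comp_assoc -!fmap_comp ext_mapE.
have [s es] : in_ext (P := const_dobj A regH X) (counit S X).
  apply/in_extP; have [U [mU _]] := cchi (PProj ord0 : pterm 1).
  have [D [e [re [c _]]]] := mU (refl_I S X); exists D, e; split=> //.
  have [y [yy _]] := const_is_product regH (fmap L c : Hom _ A) (counit S X ∘ fmap L e).
  by exists c, y.
exists s; split.
  apply: ext_unique; rewrite fmap_comp comp_assoc es fmap_id comp_idr -transpose_counit.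
  exact: transpose_unique.
by rewrite -comp_assoc refl_unit_nat comp_assoc -fmap_comp es transposeK.
Qed.

Lemma asm_extent_equivalent_under : weak_genericity S C -> tracking_prodo S C ->
  tracking_prone S C -> equivalent_under (refl_I S) (nabla regH cchi).
Proof.
move=> wg tprodo tprone; apply: (equivalent_under_of_inverse _ _ _ asm_extent_nabla).
- exact: asm_extent_full.
- exact: asm_extent_faithful.
exact: asm_extent_eso.
Qed.

End Extent.

(** * Completeness of the external filter *)

Section Terms.

(** A common language for partial combinatory functions and iterated applications [r x_1 ... x_n],
    so that the domains of both are treated at once. *)
Inductive aterm (V : Type) :=
  | AVar of V
  | AApp of aterm V & aterm V.

Fixpoint aeval (C : Category) (A : appStruct C) V (G : C) (val : V -> Hom G A)
    (t : aterm V) (w : Hom G A) : Prop :=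
  match t with
  | AVar x => w = val x
  | AApp s s' => exists a b, [/\ aeval val s a, aeval val s' b & oapp a b w]
  end.

Fixpoint aterm_of_pterm V n (y : n.-tuple V) (t : pterm n) : aterm V :=
  match t with
  | PProj i => AVar (tnth y i)
  | PApp s s' => AApp (aterm_of_pterm y s) (aterm_of_pterm y s')
  end.

Definition aterm_iapp V (t : aterm V) (xs : seq V) : aterm V :=
  foldl (fun s x => AApp s (AVar x)) t xs.

Context {C : Category} (A : OPAS C).

Lemma aeval_comp V (D G : C) (val : V -> Hom G A) (val' : V -> Hom D A) (e : Hom D G) t w :
  (forall x, val' x = val x ∘ e) -> aeval val t w -> aeval val' t (w ∘ e).
Proof.
move=> ve; elim: t w => /= [x w -> //|s IHs s' IHs' w [a [b [/IHs sa /IHs' sb ab]]]].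
by exists (a ∘ e), (b ∘ e); split=> //; exact: oapp_comp.
Qed.

Lemma aeval_fun V (G : C) (val : V -> Hom G A) t w w' :
  aeval val t w -> aeval val t w' -> w = w'.
Proof.
elim: t w w' => /= [x w w' -> -> //|s IHs s' IHs' w w' [a [b [sa sb ab]]] [a' [b' [sa' sb' ab']]]].
move: ab'; rewrite -(IHs _ _ sa sa') -(IHs' _ _ sb sb'); exact: oapp_fun.
Qed.

Lemma aeval_pterm n (t : pterm n) V (G : C) (val : V -> Hom G A) (y : n.-tuple V) v :
  aeval val (aterm_of_pterm y t) v <-> peval t (map_tuple val y) v.
Proof.
elim: t v => /= [i v|s IHs s' IHs' v]; first by rewrite tnth_map.
by split=> [[a [b [/IHs sa /IHs' sb ab]]]|[a [b [/IHs sa /IHs' sb ab]]]]; exists a, b.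
Qed.

Lemma aeval_iapp V (G : C) (val : V -> Hom G A) (t : aterm V) xs w :
  aeval val (aterm_iapp t xs) w <-> exists r, aeval val t r /\ iapp r (map val xs) w.
Proof.
elim: xs t => /= [t|x xs IH t].
  by split=> [tw|[r [tr ->]]] //; exists w.
rewrite IH; split=> [[r [[a [b [ta -> ab]]] rw]]|[a [ta [r [ar rw]]]]].
  by exists a; split=> //; exists r.
by exists r; split=> //; exists a, (val x).
Qed.

Lemma iapp_down (G : C) (r r' : Hom G A) xs w' : ole r r' -> iapp r' xs w' ->
  exists w, iapp r xs w /\ ole w w'.
Proof.
elim: xs r r' => /= [r r' le ->|x xs IH r r' le [a [ra aw]]]; first by exists r.
have [b [rb lb]] := opas_mono le (opas_refl x) ra.
by have [w [bw lw]] := IH _ _ lb aw; exists w; split=> //; exists b.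
Qed.

Lemma realizers_down n (f : pterm n.+1) (G : C) (r r' : Hom G A) :
  ole r r' -> realizers f r' -> realizers f r.
Proof.
move=> le rf D u; have [d1 d2] := rf D u; have leu := ole_comp u le.
split=> [x|y v /d2 [w [rw lw]]].
  by have [w rw] := d1 x; have [w' [rw' _]] := iapp_down leu rw; exists w'.
have [w' [rw' lw']] := iapp_down leu rw.
by exists w'; split=> //; exact: opas_trans lw' lw.
Qed.

End Terms.

(** * Realizers in the reflected algebra *)

Section Completeness.
Context {R H : Category} (limR : has_finite_limits R) (limH : has_finite_limits H).
Variables (S : lexReflection R H) (C : OPAS R).
Notation I := (refl_I S).
Notation L := (refl_R S).
Notation A := (reflected_OPAS limR S C).
Hypotheses (heyR : heyting_category R) (regH : regular_category H).
Let regR := hey_regular heyR.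

(** The right adjoint tests only subobjects of [Y], so a generalized element [y] is tested through
    its image. *)
Lemma forall_classifiable (X Y : R) (f : Hom X Y) (U : Sub X) : exists V : Sub Y,
  forall G (y : Hom G Y), mem V y <->
    forall D (u : Hom D G) (x : Hom D X), f ∘ x = y ∘ u -> mem U x.
Proof.
have [V hV] := hey_forall heyR f U.
exists V => G y; split=> [[v ev] D u x e|hy].
  have [P [g [s pb]]] := has_pullbacks regR (sub_mono V) f.
  have ms := pullback_monic pb (@sub_monic _ _ V).
  have /hV [_ /(_ _)] : is_inverse_image f V (MkSub ms) by exists g.
  case; first by exists (idm _); rewrite comp_idr.
  move=> t et; have [h [[h1 h2] _]] := pb.2 D (v ∘ u) x ltac:(by rewrite comp_assoc ev).
  by exists (t ∘ h); rewrite comp_assoc [_ ∘ t]et.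
have [M [e [m [re mm em]]]] := reg_image regR y.
have [P [g [s pb]]] := has_pullbacks regR m f.
have ms := pullback_monic pb mm.
have /hV [/(_ _)] : is_inverse_image f (MkSub mm) (MkSub ms) by exists g.
case=> [|t et _]; last by exists (t ∘ e); rewrite comp_assoc et.
have [K [k' [k pbk]]] := has_pullbacks regR e g.
apply: (mem_descent (reg_stable regR pbk re)).
by apply: (hy K k'); rewrite /= comp_assoc -pb.1 -comp_assoc -pbk.1 comp_assoc em.
Qed.

(* Universal quantification in [H] is computed in [R] and then reflected. *)
Lemma reflected_forall_classifiable (X Y : H) (f : Hom X Y) (U : Sub X) : exists V : Sub Y,
  forall G (y : Hom G Y), mem V y <->
    forall D (u : Hom D G) (x : Hom D X), f ∘ x = y ∘ u -> mem U x.
Proof.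
have mU := fmap_monic (regf_lex (refl_I_regular S)) (@sub_monic _ _ U).
have [V hV] := forall_classifiable (fmap I f) (MkSub mU).
have mV := transpose_monic (reg_finite_limits regR) (@sub_monic _ _ V).
exists (MkSub mV) => G y; split=> [[v <-] D u x e|hy].
  have [K [k1 [k2 pb]]] := has_pullbacks regR (fmap I f) (sub_mono V).
  (* The condition is evaluated at the generic element of [V] and then reflected, since [L]
     preserves the pullback. *)
  have [k' ek'] : mem (MkSub mU) k1.
    have /hV/(_ K k2 k1 pb.1) // : mem V (sub_mono V) by exists (idm _); rewrite comp_idr.
  have [c [cc' c'c]] := counit_iso S X.
  have [_ up] := (refl_R_lex S).2 _ _ _ _ _ _ _ _ pb.
  have [|z [[z1 z2] _]] := up D (c ∘ x) (v ∘ u).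
    apply: (iso_monic (counit_iso S Y)).
    rewrite !comp_assoc -!transpose_counit -{1}(comp_idr (fmap I f)) transpose_fmap.
    by rewrite -/(counit S X) -(comp_assoc f) c'c comp_idr e.
  exists (transpose k' ∘ z); rewrite comp_assoc -transpose_fmap ek'.
  by rewrite transpose_counit -comp_assoc z1 comp_assoc c'c comp_idl.
have /hV [v ev] : forall D (u : Hom D (I G)) (x : Hom D (I X)),
    fmap I f ∘ x = fmap I y ∘ u -> mem (MkSub mU) x.
  move=> D u x e; have [|t et] := hy (L D) (transpose u) (transpose x).
    by rewrite -!transpose_fmap e.
  exists (fmap I t ∘ refl_unit S D).
  by rewrite /= comp_assoc -fmap_comp et transposeK.
have [c [cc' c'c]] := counit_iso S G.
exists (fmap L v ∘ c); rewrite /= comp_assoc -transpose_comp ev.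
by rewrite -[fmap I y]comp_idr transpose_fmap -comp_assoc c'c comp_idr.
Qed.

Lemma aeval_fmapL V (Z : R) (G : H) (val : V -> Hom Z C) (val' : V -> Hom G A)
    (z : Hom G (L Z)) t w :
  (forall x, val' x = fmap L (val x) ∘ z) -> aeval val t w ->
  aeval (A := A) val' t (fmap L w ∘ z).
Proof.
move=> ve; elim: t w => /= [x w -> //|s IHs s' IHs' w [a [b [/IHs sa /IHs' sb ab]]]].
exists (fmap L a ∘ z), (fmap L b ∘ z); split=> //.
exact: (oapp_comp (A := A) z (fmapL_oapp limR S ab)).
Qed.

(** The domain [T] is built from pullbacks, which [L] preserves, so its reflection is the domain of
    the same term in [A]. *)
Lemma aeval_representable (Z : R) (t : aterm (Hom Z C)) :
  exists (T : Sub Z) (v : Hom (sub_ob T) C),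
    aeval (fun x => x ∘ sub_mono T) t v /\
    forall (G : H) (z : Hom G (L Z)) w,
      aeval (A := A) (fun x => fmap L x ∘ z) t w ->
      exists z', fmap L (sub_mono T) ∘ z' = z /\ fmap L v ∘ z' = w.
Proof.
elim: t => [x|s [T1 [v1 [ev1 h1]]] s' [T2 [v2 [ev2 h2]]]].
  exists (MkSub (iso_monic (is_iso_id Z))), x; split=> [|G z w ->] /=; first by rewrite comp_idr.
  by exists z; rewrite fmap_id comp_idl.
have [K [k1 [k2 pb]]] := has_pullbacks regR (sub_mono T1) (sub_mono T2).
have [T3 [d [d1 d2 h3]]] := lex_span_inverse_image (reg_finite_limits regR)
  (refl_R_lex S) (v1 ∘ k1) (v2 ∘ k2) (@app_monic _ C).
have m2 : monic k2 := pullback_monic pb (@sub_monic _ _ T1).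
have mm := monic_comp (monic_comp (@sub_monic _ _ T2) m2) (@sub_monic _ _ T3).
have ev1' : aeval (fun x => x ∘ sub_mono (MkSub mm)) s (v1 ∘ k1 ∘ sub_mono T3).
  rewrite -(comp_assoc v1); apply: aeval_comp ev1 => x /=.
  by rewrite -!comp_assoc (comp_assoc (sub_mono T1)) pb.1 !comp_assoc.
have ev2' : aeval (fun x => x ∘ sub_mono (MkSub mm)) s' (v2 ∘ k2 ∘ sub_mono T3).
  by rewrite -(comp_assoc v2); apply: aeval_comp ev2 => x /=; rewrite !comp_assoc.
have ev : aeval (fun x => x ∘ sub_mono (MkSub mm)) (AApp s s') (app_val C ∘ d).
  by exists (v1 ∘ k1 ∘ sub_mono T3), (v2 ∘ k2 ∘ sub_mono T3); split=> //; exists d.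
exists (MkSub mm), (app_val C ∘ d); split=> // G z w evz.
suff [z' ez'] : exists z', fmap L (sub_mono (MkSub mm)) ∘ z' = z.
  exists z'; split=> //; apply: aeval_fun evz.
  by apply: aeval_fmapL ev => x; rewrite fmap_comp -comp_assoc ez'.
case: evz => a [b [/h1 [z1 [e1 <-]] /h2 [z2 [e2 <-]] [l [l1 l2 _]]]].
have [_ up] := (refl_R_lex S).2 _ _ _ _ _ _ _ _ pb.
have [z3 [[e3 e4] _]] := up G z1 z2 (etrans e1 (esym e2)).
have [||z4 e5] := h3 G z3 l.
- by rewrite fmap_comp -comp_assoc e3.
- by rewrite fmap_comp -comp_assoc e4.
by exists z4; rewrite /= !fmap_comp -!comp_assoc e5 e4.
Qed.

(* [B], with the displayed projections, has enough generalized elements to serve as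
   the product [Z x C^n] after reflection. *)
Lemma reflected_power (Z : R) n : exists (B : R) (p : Hom B Z) (x : n.-tuple (Hom B C)),
  forall (G : H) (u : Hom G (L Z)) (y : n.-tuple (Hom G A)),
    exists h : Hom G (L B), fmap L p ∘ h = u /\ map_tuple (fun q => fmap L q ∘ h) x = y.
Proof.
elim: n => [|n [B [p [x hB]]]].
  exists Z, (idm Z), [tuple] => G u y; exists u.
  by rewrite fmap_id comp_idl; split=> //; apply: val_inj; rewrite /= (tuple0 y).
have [B' [p' [q [_ hB']]]] := product_exists S regR B C.
exists B', (p ∘ p'), [tuple of q :: map_tuple (fun r => r ∘ p') x] => G u y.
case/tupleP: y => a y; have [h [h1 h2]] := hB G u y.
have [h' [h1' h2']] := hB' G h a; exists h'; split.
  by rewrite fmap_comp -comp_assoc h1' h1.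
apply: val_inj; rewrite /= h2' -h2 /= -map_comp; congr (_ :: _); apply: eq_map => r /=.
by rewrite fmap_comp -comp_assoc h1'.
Qed.

Lemma realizers_classifiable n (f : pterm n.+1) :
  exists V : Sub (A : H), classifies V (realizers (A := A) f).
Proof.
(* First clause of [realizers]: [T1] is the domain of [r x_1 ... x_n]. *)
have [B1 [p1 [x1 h1]]] := reflected_power C n.
have [T1 [v1 [ev1 r1]]] := aeval_representable (aterm_iapp (AVar p1) x1).
(* Second clause: [T2] is the domain of [f], [T3] the part of it where [r y] is defined, and [T4]
   the part of [T3] where [r y <= f y]. *)
have [B2 [p2 [x2 h2]]] := reflected_power C n.+1.
have [T2 [v2 [ev2 r2]]] := aeval_representable (aterm_of_pterm x2 f).
have [T3 [v3 [ev3 r3]]] := aeval_representable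
  (aterm_iapp (AVar (p2 ∘ sub_mono T2)) (map (fun x => x ∘ sub_mono T2) x2)).
have [T4 [l [l1 l2 r4]]] := lex_span_inverse_image (reg_finite_limits regR)
  (refl_R_lex S) v3 (v2 ∘ sub_mono T3) (@le_monic _ C).
have mL X (T : Sub X) := fmap_monic (refl_R_lex S) (@sub_monic _ _ T).
have m34 := fmap_monic (refl_R_lex S) (monic_comp (@sub_monic _ _ T3) (@sub_monic _ _ T4)).
have [V1 hV1] := reflected_forall_classifiable (fmap L p1) (MkSub (mL _ T1)).
have [V2 hV2] := reflected_forall_classifiable (fmap L (p2 ∘ sub_mono T2)) (MkSub m34).
have [V hV] := sub_meet regH V1 V2.
exists V => G r; split=> [/hV [/hV1 m1 /hV2 m2] D u|rr].
  split=> [x|y v].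
    have [h [hr hx]] := h1 D (r ∘ u) x.
    have [h' eh] := m1 D u h hr.
    have vE (q : Hom B1 C) : fmap L q ∘ h = fmap L (q ∘ sub_mono T1) ∘ h'.
      by rewrite fmap_comp -comp_assoc eh.
    have /aeval_iapp [r' [-> ia]] := aeval_fmapL vE ev1.
    by exists (fmap L v1 ∘ h'); rewrite -hx -hr.
  have [h [hr <-]] := h2 D (r ∘ u) y.
  move=> /aeval_pterm /r2 [z [ez <-]].
  have [|z' /= ez'] := m2 D u z; first by rewrite fmap_comp -comp_assoc ez.
  rewrite fmap_comp -comp_assoc in ez'.
  have vE (q : Hom (sub_ob T2) C) :
      fmap L q ∘ z = fmap L (q ∘ sub_mono T3) ∘ (fmap L (sub_mono T4) ∘ z').
    by rewrite fmap_comp -comp_assoc ez'.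
  have /aeval_iapp [r' [er ia]] := aeval_fmapL vE ev3.
  exists (fmap L v3 ∘ (fmap L (sub_mono T4) ∘ z')); split.
    move: ia; rewrite er fmap_comp -comp_assoc ez hr -map_comp.
    rewrite (_ : map _ x2 = map (fun q => fmap L q ∘ h) x2) //.
    by apply: eq_map => q /=; rewrite fmap_comp -comp_assoc ez.
  exists (fmap L l ∘ z'); rewrite /= !comp_assoc -!fmap_comp l1 l2; split=> //.
  by rewrite -ez' !fmap_comp !comp_assoc.
apply/hV; split; [apply/hV1 => D u b e|apply/hV2 => D u z e].
  have [w iw] := (rr D u).1 (map_tuple (fun q => fmap L q ∘ b) x1).
  have [|b' [eb _]] := r1 D b w; last by exists b'.
  by apply/aeval_iapp; exists (fmap L p1 ∘ b); rewrite e.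
have pv : peval (A := A) f (map_tuple (fun q : Hom B2 C =>
    fmap L q ∘ (fmap L (sub_mono T2) ∘ z)) x2) (fmap L v2 ∘ z).
  by apply/aeval_pterm; apply: aeval_fmapL ev2 => x; rewrite fmap_comp comp_assoc.
have [w [iw lw]] := (rr D u).2 _ _ pv.
have [|z3 [e3 ew]] := r3 D z w.
  apply/aeval_iapp; exists (r ∘ u); split=> //; rewrite -map_comp.
  rewrite (_ : map _ _ = map (fun q => fmap L q ∘ (fmap L (sub_mono T2) ∘ z)) x2) //.
  by apply: eq_map => q /=; rewrite fmap_comp comp_assoc.
case: lw => l' [e1 e2].
have [||z4 e4] := r4 D z3 l'.
- by rewrite [LHS]e1 ew.
- by rewrite [LHS]e2 fmap_comp -comp_assoc e3.
by exists z4; rewrite /= fmap_comp -comp_assoc e4.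
Qed.

Lemma iapp_fmapL (Z : R) (G : H) (h : Hom G (L Z)) (r : Hom Z C) xs w :
  iapp r xs w ->
  iapp (A := A) (fmap L r ∘ h) (map (fun q => fmap L q ∘ h) xs) (fmap L w ∘ h).
Proof.
elim: xs r => /= [r ->|x xs IH r [a [ra /IH iw]]] //.
by exists (fmap L a ∘ h); split=> //; exact: (oapp_comp (A := A) h (fmapL_oapp limR S ra)).
Qed.

(** Tuples in [A] are instances of the generic tuple over [B], restricted to the domain of [f] for
    the second clause; there the hypothesis on [r] applies in [R]. *)
Lemma realizers_fmapL n (f : pterm n.+1) (Z : R) (r : Hom Z C) :
  realizers f r -> realizers (A := A) f (fmap L r).
Proof.
move=> rr G u; split=> [x|y v].
  have [B [p [q hB]]] := reflected_power Z n.
  have [h [hu <-]] := hB G u x; have [w iw] := (rr B p).1 q.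
  exists (fmap L w ∘ h); have := iapp_fmapL h iw.
  by rewrite fmap_comp -comp_assoc hu.
have [B [p [q hB]]] := reflected_power Z n.+1.
have [T [v0 [ev0 rep]]] := aeval_representable (aterm_of_pterm q f).
have [h [hu <-]] := hB G u y; move=> /aeval_pterm /rep [z [ez <-]].
have [w [iw lw]] := (rr _ (p ∘ sub_mono T)).2 _ _ ((aeval_pterm _ _ _ _).1 ev0).
exists (fmap L w ∘ z); split; last exact: (ole_comp (A := A) z (fmapL_ole limR S lw)).
have := iapp_fmapL z iw; rewrite !fmap_comp -!comp_assoc ez hu -map_comp.
rewrite (_ : map _ _ = map (fun q => fmap L q ∘ h) q) //.
by apply: eq_map => x /=; rewrite fmap_comp -comp_assoc ez.
Qed.

Hypothesis fsC : filter_structure limR limH S C.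
Hypothesis ccC : forall n (f : pterm n.+1), inhabited (realizers (A := C) f).

(** The downset of realizers meets [C] because [C] locally contains realizers, which reflect to
    realizers in [A]. *)
Lemma generic_filter_complete : ef_complete (generic_filter fsC regR).
Proof.
move=> n f; have [V cV] := realizers_classifiable f.
have dn (G : H) (x y : Hom G A) : ole x y -> mem V y -> mem V x.
  by move=> le /cV ry; apply/cV; exact: realizers_down le ry.
exists (MkDownset dn); split=> // G; have [D [e [re [r rr]]]] := ccC f G.
by exists D, e; split=> //; exists r; apply/cV; exact: realizers_fmapL.
Qed.

End Completeness.

Theorem theorem2p2p17 (X : regularRealizabilityCategory) :
  exists (chi : external_filter (rrRC X)) (chi_complete : ef_complete chi),
    equivalent_under (rrI X) (nabla (rr_regular X) chi_complete).
Proof.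
case: X => R H heyR regH S C fsC wg tprodo tprone.
have ccC n (f : pterm n.+1) : inhabited (realizers (A := C) f).
  move=> G; have [D [e [re [r [_ rr]]]]] := @opca_complete _ C n f G.
  by exists D, e; split=> //; exists r.
pose cchi := generic_filter_complete heyR regH fsC ccC.
exists (generic_filter fsC (hey_regular heyR)), cchi.
exact: asm_extent_equivalent_under wg tprodo tprone.
Qed.
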